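(* Let $d\ge 1$ and let $\mathcal{X}$ be a spatial Poisson process on $\mathbb{R}^d$ with intensity function $\lambda:\mathbb{R}^d\to[0,\infty)$ satisfying $\lambda(x)=o(1+\log^+(|x|))$ as $|x|\to\infty$. Then with probability one the sampling inequality fails for every subset $\mathcal{Y}$ of $\mathcal{X}$; that is, almost surely, for every subset $\mathcal{Y}\subseteq\mathcal{X}$ there do not exist constants $A,B>0$ such that $$A\|f\|_2^2\le\sum_{y\in\mathcal{Y}}|f(y)|^2\le B\|f\|_2^2\qquad\text{for all } f\in\mathcal{B}.$$
   Context: The space of bandlimited functions is $\mathcal{B}=\{f\in L^2(\mathbb{R}^d): \operatorname{supp}\hat f\subseteq[-1/2,1/2]^d\}$, where $\hat f(\xi)=\int_{\mathbb{R}^d}f(x)e^{-2\pi i x\cdot\xi}\,dx$; each $f\in\mathcal{B}$ is identified with its continuous representative, and $\|\cdot\|_2$ is the norm of $L^2(\mathbb{R}^d)$. A spatial Poisson process $\mathcal{X}$ with (measurable) intensity function $\lambda$ is a random set of points in $\mathbb{R}^d$ such that for every Borel set $A\subseteq\mathbb{R}^d$ the number of points in $\mathcal{X}\cap A$ is a Poisson random variable with parameter $\int_A\lambda(x)\,dx$, and for disjoint Borel sets $A_1,\dots,A_n$ the numbers of points in $\mathcal{X}\cap A_i$, $i=1,\dots,n$, are independent. Here $\log^+ t=\max(\log t,0)$ and $|x|$ is the Euclidean norm. *)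

(* Defs.v *)
From HB Require Import structures.
From mathcomp Require Import all_boot all_order all_algebra.
From mathcomp Require Import all_classical all_reals all_analysis.
From mathcomp Require Import measurable_realfun complex.

Set Implicit Arguments.
Unset Strict Implicit.
Unset Printing Implicit Defensive.

Import Order.TTheory GRing.Theory Num.Theory.
Import numFieldNormedType.Exports.
Import ComplexField.Normc.

Local Open Scope classical_set_scope.
Local Open Scope complex_scope.
Local Open Scope ring_scope.

(** * Borel sets and Lebesgue measure on R^n = 'rV[R]_n *)

Definition borel_display : measure_display.
Proof. exact: default_measure_display. Qed.

Section borel_rV.
Variables (R : realType) (n : nat).

Definition borel_rV : set (set 'rV[R]_n) := <<s @open 'rV[R]_n >>.

Let borel_rV0 : borel_rV set0.
Proof. exact: sigma_algebra0. Qed.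

Let borel_rVC A : borel_rV A -> borel_rV (~` A).
Proof. exact: sigma_algebraC. Qed.

Let borel_rV_bigcup (F : (set 'rV[R]_n)^nat) :
  (forall i, borel_rV (F i)) -> borel_rV (\bigcup_i F i).
Proof. exact: (@sigma_algebra_bigcup _ setT). Qed.

HB.instance Definition _ := @isMeasurable.Build borel_display
  'rV[R]_n borel_rV borel_rV0 borel_rVC borel_rV_bigcup.

End borel_rV.

Section rV_measurable.
Variable R : realType.

Lemma open_measurable_rV n (U : set 'rV[R]_n) : open U -> measurable U.
Proof. exact: sub_sigma_algebra. Qed.

Lemma open_bigcup_ball n (U : set 'rV[R]_n) : open U ->
  U = \bigcup_(qk : 'rV[rat]_n * nat)
        [set x | ball (map_mx ratr qk.1 : 'rV[R]_n) qk.2.+1%:R^-1 `<=` U /\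
                 ball (map_mx ratr qk.1 : 'rV[R]_n) qk.2.+1%:R^-1 x].
Proof.
move=> oU; apply/seteqP; split => [x Ux|x [qk _ [+ +]]]; last exact.
move: oU; rewrite openE => /(_ _ Ux) /nbhs_ballP[e /= e0 xeU].
have [k ke] : exists k : nat, k.+1%:R^-1 < e / 2.
  have [k _ /(_ k (leqnn _)) /= kE] :=
    near_infty_natSinv_lt (PosNum (divr_gt0 e0 (@ltr0Sn R 1))).
  by exists k.
have k0 : 0 < k.+1%:R^-1 :> R by rewrite invr_gt0.
have /choice[q xq] : forall j : 'I_n, exists q : rat,
    ball (x ord0 j) (k.+1%:R^-1) (ratr q : R).
  move=> j; have [r [xr [q _ qr]]] :
      ball (x ord0 j) (k.+1%:R^-1) `&` (@ratr R @` setT) !=set0.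
    by apply: dense_rat; [exists (x ord0 j); exact: ballxx|exact: ball_open].
  by exists q; rewrite qr.
have xqb : ball (map_mx ratr (\row_j q j) : 'rV[R]_n) k.+1%:R^-1 x.
  by split=> // i j; rewrite !mxE ord1; apply: ball_sym; exact: xq.
exists (\row_j q j, k) => //=; split => // y qy; apply: xeU.
apply: le_ball (ball_triangle (ball_sym xqb) qy).
by rewrite [leRHS]splitr lerD// ltW.
Qed.

Lemma measurable_fun_rV d (T : measurableType d) n (f : T -> 'rV[R]_n) :
  (forall j, measurable_fun setT (fun x => f x ord0 j)) ->
  measurable_fun setT f.
Proof.
move=> mf; apply: (@measurability _ _ _ _ _ f (@open 'rV[R]_n)) => //.
move=> _ [U oU <-]; rewrite setTI (open_bigcup_ball oU) preimage_bigcup.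
apply: countable_bigcupT_measurable; first exact: countableP.
move=> [q k] /=; set b := ball _ _.
have [kU|kU] := pselect (b `<=` U); last first.
  by rewrite (_ : _ @^-1` _ = set0) //; apply/seteqP; split => // x [].
rewrite (_ : _ @^-1` _ = \bigcap_(j in [set: 'I_n])
    ((fun x => f x ord0 j) @^-1` ball (ratr (q ord0 j) : R) k.+1%:R^-1)).
  apply: fin_bigcap_measurable; first exact: finite_finset.
  move=> j _; rewrite -[X in measurable X]setTI; apply: mf => //.
  by apply: open_measurable; exact: ball_open.
apply/seteqP; split => [x [_ [_ h]] j _|x h].
  by have := h ord0 j; rewrite mxE.
by split => //; split => [|i j]; [rewrite invr_gt0|rewrite mxE ord1; exact: h].
Qed.

Lemma continuous_measurable_rV n (f : 'rV[R]_n -> R) :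
  continuous f -> measurable_fun setT f.
Proof.
move=> cf; apply: (@measurability _ _ _ _ setT f (@RGenOpens.G R)).
  exact: RGenOpens.measurableE.
move=> _ [_ [a [b ->]] <-]; rewrite setTI; apply: open_measurable_rV.
by apply: open_comp => // x _; exact: cf.
Qed.

Lemma measurable_coord n j : measurable_fun setT (fun x : 'rV[R]_n => x ord0 j).
Proof. by apply: continuous_measurable_rV; exact: coord_continuous. Qed.

End rV_measurable.

Section cons_rV.
Variable R : realType.

Definition cons_rV n (p : measurableTypeR R * 'rV[R]_n) : 'rV[R]_n.+1 := row_mx p.1%:M p.2.

Let uncons_rV n (x : 'rV[R]_n.+1) : measurableTypeR R * 'rV[R]_n :=
  (x ord0 ord0, \row_j x ord0 (lift ord0 j)).

Lemma cons_rV0 n (p : R * 'rV[R]_n) : cons_rV p ord0 ord0 = p.1.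
Proof.
rewrite /cons_rV (_ : ord0 = lshift n (ord0 : 'I_1) :> 'I_n.+1); last exact: val_inj.
by rewrite (row_mxEl (p.1%:M : 'M[R]_1)) mxE.
Qed.

Lemma cons_rVS n (p : R * 'rV[R]_n) j : cons_rV p ord0 (lift ord0 j) = p.2 ord0 j.
Proof.
rewrite /cons_rV (_ : lift ord0 j = rshift 1 j :> 'I_n.+1); last exact: val_inj.
by rewrite (row_mxEr (p.1%:M : 'M[R]_1)).
Qed.

Let uncons_rVK n : cancel (@cons_rV n) (@uncons_rV n).
Proof.
move=> [t v]; rewrite /uncons_rV cons_rV0; congr pair.
by apply/rowP => j; rewrite mxE cons_rVS.
Qed.

Lemma measurable_cons_rV n : measurable_fun setT (@cons_rV n).
Proof.
apply: measurable_fun_rV => j; case: (unliftP ord0 j) => [i ->|->].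
  under eq_fun do rewrite cons_rVS.
  by apply: measurableT_comp (measurable_coord i) _; exact: measurable_snd.
by under eq_fun do rewrite cons_rV0; exact: measurable_fst.
Qed.

Let measurable_uncons_rV n : measurable_fun setT (@uncons_rV n).
Proof.
apply/measurable_fun_pairP; split; first exact: measurable_coord.
apply: measurable_fun_rV => j.
by under eq_fun do rewrite /= mxE; exact: measurable_coord.
Qed.

Section push_cons_rV.
Variables (n : nat) (mu : {sigma_finite_measure set 'rV[R]_n -> \bar R}).

Let push := pushforward ((@lebesgue_measure R) \x mu)%E (@cons_rV n).

Let mcons A : measurable A -> measurable (@cons_rV n @^-1` A).
Proof.
by move=> mA; rewrite -[X in measurable X]setTI; exact: measurable_cons_rV.
Qed.

Let push0 : push set0 = 0%E.
Proof. by rewrite /push /pushforward preimage_set0; exact: measure0. Qed.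

Let push_ge0 A : (0 <= push A)%E.
Proof. by rewrite /push /pushforward; exact: measure_ge0. Qed.

Let push_sigma_additive : semi_sigma_additive push.
Proof.
move=> F mF tF mUF; rewrite /push /pushforward preimage_bigcup.
apply: measure_semi_sigma_additive.
- by move=> i; exact: mcons.
- apply/trivIsetP => i j _ _ ij; rewrite -preimage_setI.
  by move/trivIsetP : tF => /(_ _ _ _ _ ij) ->//; rewrite preimage_set0.
- by rewrite -preimage_bigcup; exact: mcons.
Qed.

HB.instance Definition _ := isMeasure.Build _ _ _ push
  push0 push_ge0 push_sigma_additive.

Let push_sigma_finite : sigma_finite setT push.
Proof.
have /sigma_finiteP[F [TF ndF Foo]] := sigma_finiteT (@lebesgue_measure R).
have /sigma_finiteP[G [TG ndG Goo]] := sigma_finiteT mu.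
exists (fun k => @uncons_rV n @^-1` (F k `*` G k)).
  rewrite -preimage_bigcup; apply/seteqP; split => // x _ /=.
  have [i _ Fi] : (\bigcup_i F i) (x ord0 ord0) by rewrite -TF.
  have [j _ Gj] : (\bigcup_i G i) (uncons_rV x).2 by rewrite -TG.
  exists (maxn i j) => //; split.
    by move: Fi; exact/subsetPset/ndF/leq_maxl.
  by move: Gj; exact/subsetPset/ndG/leq_maxr.
move=> k; have [mF Fk] := Foo k; have [mG Gk] := Goo k; split.
  rewrite -[X in measurable X]setTI; apply: measurable_uncons_rV => //.
  exact: measurableX.
rewrite /push /pushforward -comp_preimage.
rewrite (_ : _ \o _ = id); last by apply/funext => p; exact: uncons_rVK.
by rewrite preimage_id product_measure1E// lte_mul_pinfty// ge0_fin_numE.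
Qed.

HB.instance Definition _ := Measure_isSigmaFinite.Build _ _ _ push
  push_sigma_finite.

Definition push_cons_rV : {sigma_finite_measure set 'rV[R]_n.+1 -> \bar R} := push.

End push_cons_rV.

End cons_rV.

Section lebesgue_rV.
Variable R : realType.

Fixpoint lebesgue_rV n : set 'rV[R]_n -> \bar R :=
  match n with
  | 0%N => \d_(0 : 'rV[R]_0)
  | n'.+1 => pushforward ((@lebesgue_measure R) \x (@lebesgue_rV n'))%E
                         (@cons_rV R n')
  end.

Lemma lebesgue_rV_measure n :
  exists mu : {sigma_finite_measure set 'rV[R]_n -> \bar R},
    mu = @lebesgue_rV n :> (_ -> _).
Proof.
elim: n => [|n [mu muE]]; first by exists \d_(0 : 'rV[R]_0).
by exists (push_cons_rV mu); rewrite /= -muE.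
Qed.

Section instances.
Variable n : nat.

Let lebesgue_rV0 : @lebesgue_rV n set0 = 0%E.
Proof. by have [mu <-] := lebesgue_rV_measure n; exact: measure0. Qed.

Let lebesgue_rV_ge0 A : (0 <= @lebesgue_rV n A)%E.
Proof. by have [mu <-] := lebesgue_rV_measure n; exact: measure_ge0. Qed.

Let lebesgue_rV_sigma_additive : semi_sigma_additive (@lebesgue_rV n).
Proof.
by have [mu <-] := lebesgue_rV_measure n; exact: measure_semi_sigma_additive.
Qed.

HB.instance Definition _ := isMeasure.Build _ _ _ (@lebesgue_rV n)
  lebesgue_rV0 lebesgue_rV_ge0 lebesgue_rV_sigma_additive.

Let lebesgue_rV_sigma_finite : sigma_finite setT (@lebesgue_rV n).
Proof. by have [mu <-] := lebesgue_rV_measure n; exact: sigma_finiteT. Qed.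

HB.instance Definition _ := Measure_isSigmaFinite.Build _ _ _ (@lebesgue_rV n)
  lebesgue_rV_sigma_finite.

End instances.

(* The defining property of Lebesgue measure: boxes have the expected volume. *)
Lemma lebesgue_rV_box n (B : 'I_n -> set R) :
  (forall j, measurable (B j)) ->
  lebesgue_rV [set x : 'rV[R]_n | forall j, B j (x ord0 j)] =
  (\prod_(j < n) lebesgue_measure (B j))%E.
Proof.
elim: n B => [|n IH] B mB.
  by rewrite big_ord0 /= diracE mem_set //=; case.
rewrite big_ord_recl -(IH (fun j => B (lift ord0 j)))//=.
have [mu muE] := lebesgue_rV_measure n; rewrite -muE.
have mB' : measurable [set v : 'rV[R]_n | forall j, B (lift ord0 j) (v ord0 j)].
  rewrite (_ : mkset _ = \bigcap_(j in [set: 'I_n])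
      ((fun v : 'rV[R]_n => v ord0 j) @^-1` B (lift ord0 j))).
    apply: fin_bigcap_measurable => [|j _]; first exact: finite_finset.
    rewrite -[X in measurable X]setTI.
    by apply: (@measurable_coord R n j) => //; exact: mB.
  by apply/seteqP; split => [v h j _|v h j]; [exact: h|exact: h].
rewrite /pushforward (_ : _ @^-1` _ =
    B ord0 `*` [set v : 'rV[R]_n | forall j, B (lift ord0 j) (v ord0 j)]).
  by rewrite product_measure1E//; exact: mB.
apply/seteqP; split => [[t v] /= h|[t v] [/= ht hv] j].
  split => [|j] /=; first by have := h ord0; rewrite cons_rV0.
  by have := h (lift ord0 j); rewrite cons_rVS.
by case: (unliftP ord0 j) => [i ->|->]; rewrite ?cons_rVS ?cons_rV0.
Qed.

End lebesgue_rV.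

(** * Bandlimited functions *)

Section bandlimited.
Variables (R : realType) (d : nat).
Local Notation Rd := 'rV[R]_d.
Local Notation leb := (@lebesgue_rV R d).
Local Notation normc := (@ComplexField.Normc.normc R).

Definition dotr (x y : Rd) : R := \sum_(j < d) x ord0 j * y ord0 j.

(* The library norm `|x| on 'rV[R]_d is the sup norm; this is the Euclidean one. *)
Definition enorm (x : Rd) : R := Num.sqrt (dotr x x).

Definition cis (t : R) : R[i] := cos t +i* sin t.

Definition Cintegral (f : Rd -> R[i]) : R[i] :=
  (\int[leb]_x complex.Re (f x)) +i* (\int[leb]_x complex.Im (f x)).

Definition LpnormC (p : R) (f : Rd -> R[i]) : \bar R :=
  'N[leb]_(p%:E)[EFin \o normc \o f].

Definition LpC (p : R) (f : Rd -> R[i]) : Prop :=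
  [/\ measurable_fun setT (fun x => complex.Re (f x)),
      measurable_fun setT (fun x => complex.Im (f x)) &
      (LpnormC p f < +oo)%E].

Definition fourier_integral (f : Rd -> R[i]) (xi : Rd) : R[i] :=
  Cintegral (fun x => f x * cis (- (2 * pi * dotr x xi))).

(* The Fourier transform on L^2 is the continuous extension of the integral
   from L^1 `&` L^2; [is_fourier f g] says that g represents the transform
   of the L^2 function f. *)
Definition is_fourier (f g : Rd -> R[i]) : Prop :=
  [/\ LpC 2 f, LpC 2 g &
   exists u : nat -> Rd -> R[i],
    [/\ forall n, LpC 1 (u n) /\ LpC 2 (u n),
        LpnormC 2 (fun x => u n x - f x) @[n --> \oo] --> 0%E &
        LpnormC 2 (fun xi => fourier_integral (u n) xi - g xi)
          @[n --> \oo] --> 0%E]].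

(* Support of an almost-everywhere class: the complement of the largest open
   set on which g vanishes almost everywhere. *)
Definition ae_support (g : Rd -> R[i]) : set Rd :=
  ~` \bigcup_(U in [set U : set Rd | open U /\
        {ae leb, forall x, U x -> g x = 0}]) U.

Definition half_cube : set Rd :=
  [set xi | forall j, - 2^-1 <= xi ord0 j <= 2^-1].

(* A class in the space is represented by its continuous representative. *)
Definition bandlimited : set (Rd -> R[i]) :=
  [set f | continuous (f : Rd -> (R[i] : numFieldType)) /\
     exists2 g, is_fourier f g & ae_support g `<=` half_cube].

Definition sampling_inequality (Y : set Rd) : Prop :=
  exists A B : R, [/\ 0 < A, 0 < B &
    forall f, bandlimited f ->
      (A%:E * LpnormC 2 f ^+ 2 <= \esum_(y in Y) (normc (f y) ^+ 2)%:E /\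
       \esum_(y in Y) (normc (f y) ^+ 2)%:E <= B%:E * LpnormC 2 f ^+ 2)%E].

(* The filter of neighbourhoods of infinity, i.e. |x| --> +oo. *)
Definition rV_infty : set_system Rd :=
  filter_from [set: R] (fun M => [set x | M < enorm x]).

Global Instance rV_infty_filter : Filter rV_infty.
Proof.
apply: filter_from_filter; first by exists 0.
move=> M N _ _; exists (Num.max M N) => // x /=.
by rewrite gt_max => /andP[].
Qed.

Canonical rV_infty_filter_on := FilterType rV_infty rV_infty_filter.

Definition logp (t : R) : R := Num.max (ln t) 0.

End bandlimited.
Arguments rV_infty {R d}.

(** * Spatial Poisson processes *)

Section poisson_process.
Local Open Scope ereal_scope.

Definition independent_RVs d d' (Omega : measurableType d)
    (T : measurableType d') (R : realType) (P : probability Omega R) (n : nat)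
    (Z : 'I_n -> Omega -> T) : Prop :=
  forall B : 'I_n -> set T, (forall i, measurable (B i)) ->
    P (\bigcap_(i in [set: 'I_n]) (Z i @^-1` B i)) =
    \prod_(i < n) P (Z i @^-1` B i).

(* N is a Poisson random variable with parameter m, where m = +oo means that N
   is almost surely infinite. The formula is spelled out since the library's
   [poisson_pmf] has the value 1 for every k when the rate is 0. *)
Definition poisson_RV d (Omega : measurableType d) (R : realType)
    (P : probability Omega R) (m : \bar R) (N : Omega -> \bar R) : Prop :=
  measurable_fun setT N /\
  match m with
  | r%:E => forall k : nat,
      P (N @^-1` [set k%:R%:E]) = (expR (- r) * r ^+ k / k`!%:R)%:E
  | +oo => P (N @^-1` [set +oo]) = 1
  | -oo => False
  end.

Definition poisson_process d (Omega : measurableType d) (R : realType)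
    (P : probability Omega R) (n : nat) (lambda : 'rV[R]_n -> R)
    (X : Omega -> set 'rV[R]_n) : Prop :=
  let N (A : set 'rV[R]_n) (w : Omega) : \bar R := counting (X w `&` A) in
  (forall A, measurable A ->
     poisson_RV P (\int[@lebesgue_rV R n]_(x in A) (lambda x)%:E) (N A)) /\
  (forall (k : nat) (A : 'I_k -> set 'rV[R]_n),
     (forall i, measurable (A i)) -> trivIset setT A ->
     independent_RVs P (fun i => N (A i))).

End poisson_process.

(* Main.v *)
Require Import Defs.
From HB Require Import structures.
From mathcomp Require Import all_boot all_order all_algebra.
From mathcomp Require Import all_classical all_reals all_analysis.
From mathcomp Require Import measurable_realfun complex.
From mathcomp Require Import ring lra.
From mathcomp Require finmap.

Set Implicit Arguments.
Unset Strict Implicit.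
Unset Printing Implicit Defensive.

Import Order.TTheory GRing.Theory Num.Theory.
Import numFieldNormedType.Exports.

Local Open Scope classical_set_scope.
Local Open Scope ring_scope.

(** Write s (x) = (sin (pi x / 2) / x)^2, h (x) = s (x + 1) - s (x - 1) and
    g (x) = s (x + 1) + s (x - 1).  All three are integrable with Fourier
    transform supported in [-1/2, 1/2] ([bandlimited_line_sinc2]).  This needs
    no inversion formula: the product sin^2 (A) cos (2 B) is a combination of
    squared sines, and the integral of (sin (b x) / x)^2 is proportional to |b|
    by scaling, so that the cosine transform of s at a frequency theta is
    proportional to |pi + theta| + |pi - theta| - 2 |theta|, which vanishes for
    |theta| >= pi.

    Up to the common factor (sin (pi (x + 1) / 2) / (x^2 - 1))^2, the function h
    is - 4 x and g is 2 x^2 + 2, so that h decays faster than g: |h| <= g and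
    |x| |h (x)| <= 2 g (x) ([sinc_diff_decay]).  Taking tensor
    products and translating by c gives bandlimited functions f_c and g_c on
    R^d, with norms independent of c, such that |f_c| <= (2 / K) |g_c| outside
    of the cube of half side K around c.  If Y misses that cube, a sampling
    inequality for Y yields
      A ||f||^2 <= sum_Y |f_c|^2 <= (2 / K)^2 sum_Y |g_c|^2
                <= (2 / K)^2 B ||g||^2,
    which is impossible for large K.  Hence a set with holes of every size, and
    with it each of its subsets, satisfies no sampling inequality
    ([holes_sampling_fails]).  The upper bound replaces any counting of the
    points of Y.

    It remains to see that the Poisson process almost surely has holes of every
    size ([ae_holes]).  In a row of disjoint cubes of side S, the k-th one lies
    within distance O(k) of the origin, so the integral of the intensity over it
    is eventually at most S^d * S^-d * (1 + log^+ (C k)), and it contains no point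
    with probability at least c / k for some c > 0.  The harmonic series diverges
    and disjoint cubes are independent, so almost surely some cube of the row is
    empty ([ae_void]). *)

(** * Affine changes of variable on the line *)

Section affine_change_of_variable.
Variable R : realType.
Local Notation mu := (@lebesgue_measure R).

Definition affine (a c : R) (x : measurableTypeR R) : measurableTypeR R := a * x + c.

Lemma measurable_affine a c : measurable_fun setT (affine a c).
Proof. by apply: measurable_funD => //; exact: measurable_funM. Qed.

(** The structure is given by name because unification on pushforward would select
   the one attached to push_cons_rV. *)
Let image_measure a c : {measure set (measurableTypeR R) -> \bar R} :=
  measure_function_pushforward__canonical__measure_function_Measure mu
    (measurable_affine a c).

Let lebesgue_measure_affine_gt0 (a c : R) (a0 : 0 < a) (A : set (measurableTypeR R)) :
  measurable A -> (a%:E * mu (affine a c @^-1` A))%E = mu A.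
Proof.
move=> mA.
pose nu := mscale (NngNum (ltW a0)) (image_measure a c).
rewrite -[LHS]/(nu A); apply/esym/lebesgue_measure_unique => // _ [[u v]] _ <- /=.
rewrite /nu /mscale /= /pushforward.
have -> : affine a c @^-1` `]u, v] = `](u - c) / a, (v - c) / a]%classic.
  apply/seteqP; split => x /=; rewrite /affine !in_itv/=;
  by rewrite ltr_pdivrMr// ler_pdivlMr// ltrBlDr lerBrDr (mulrC a).
rewrite !lebesgue_measure_itv/= !lte_fin ltr_pM2r ?invr_gt0// ltrD2r.
case: ifPn => uv; last by rewrite mule0.
rewrite -!EFinB -EFinM; congr EFin.
by field; rewrite gt_eqF.
Qed.

(** Both sides are measures in A, so half-open intervals decide when a > 0; the
    preimage of such an interval under a decreasing map is closed on the other
    side, and the case a < 0 is reduced to a > 0 by the symmetry of the measure. *)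
Lemma lebesgue_measure_affine (a c : R) (a0 : a != 0) (A : set (measurableTypeR R)) :
  measurable A -> (`|a|%:E * mu (affine a c @^-1` A))%E = mu A.
Proof.
move=> mA; case: (ltgtP a 0) => [aN|aP|/eqP]; last by rewrite (negbTE a0).
  rewrite ltr0_norm// -[RHS](@lebesgue_measure_affine_gt0 (- a) c) ?oppr_gt0//.
  congr (_ * _)%E; rewrite -[RHS]lebesgue_measureN; last first.
    by rewrite -[X in measurable X]setTI; exact: measurable_affine.
  rewrite /pushforward; congr mu; apply/seteqP; split => x /=;
  by rewrite /affine mulrNN.
by rewrite gtr0_norm// lebesgue_measure_affine_gt0.
Qed.

Let norm_nng (a : R) : {nonneg R} := NngNum (normr_ge0 a).

Lemma ge0_integral_affine (a c : R) (f : R -> \bar R) : a != 0 ->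
  measurable_fun setT f -> (forall x, 0 <= f x)%E ->
  (`|a|%:E * \int[mu]_x f (affine a c x) = \int[mu]_x f x)%E.
Proof.
move=> a0 mf f0.
transitivity (\int[mscale (norm_nng a) (image_measure a c)]_x f x)%E.
  rewrite ge0_integral_mscale//= ge0_integral_pushforward//.
  exact: measurable_affine.
apply: eq_measure_integral => A mA _.
exact: lebesgue_measure_affine.
Qed.

Lemma integrable_affine (a c : R) (f : R -> R) : a != 0 ->
  mu.-integrable setT (EFin \o f) ->
  mu.-integrable setT (EFin \o (f \o affine a c)).
Proof.
move=> a0 /integrableP[mf foo]; apply/integrableP; split.
  by apply: measurableT_comp mf _; exact: measurable_affine.
move: foo; rewrite -(ge0_integral_affine c a0) => [|//|//]; last first.
  exact: measurableT_comp.
move=> h; rewrite ltey; apply/eqP => hoo; move: h.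
by rewrite (_ : (\int[mu]_x _)%E = +oo%E)// gt0_muley ?ltxx// lte_fin normr_gt0.
Qed.

Lemma Rintegral_affine (a c : R) (f : R -> R) : a != 0 ->
  mu.-integrable setT (EFin \o f) ->
  `|a| * \int[mu]_x f (affine a c x) = \int[mu]_x f x.
Proof.
move=> a0 intf.
have mf := measurable_int _ intf.
have intfa := integrable_affine c a0 intf.
apply: EFin_inj; rewrite EFinM /Rintegral !fineK; last 2 first.
- exact: integrable_fin_num intf.
- exact: integrable_fin_num intfa.
rewrite [in LHS]integralE [in RHS]integralE.
rewrite muleBr//; last exact: integrable_add_def.
congr (_ - _)%E.
- rewrite -(ge0_integral_affine c a0 (measurable_funepos mf) (funepos_ge0 _)).
  congr (_ * _)%E; apply: eq_integral => x _.
  by rewrite -/((EFin \o f \o affine a c)^\+%E x) funepos_comp.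
- rewrite -(ge0_integral_affine c a0 (measurable_funeneg mf) (funeneg_ge0 _)).
  congr (_ * _)%E; apply: eq_integral => x _.
  by rewrite -/((EFin \o f \o affine a c)^\-%E x) funeneg_comp.
Qed.

End affine_change_of_variable.

(** * Complex integrals and tensor products *)

Section real_tensor.
Context d1 d2 (T1 : measurableType d1) (T2 : measurableType d2) (R : realType).
Variables (m1 : {sigma_finite_measure set T1 -> \bar R})
          (m2 : {sigma_finite_measure set T2 -> \bar R}).

Lemma integrable_tensor (f : T1 -> R) (g : T2 -> R) :
  m1.-integrable setT (EFin \o f) -> m2.-integrable setT (EFin \o g) ->
  (m1 \x m2)%E.-integrable setT (EFin \o (fun p => f p.1 * g p.2)).
Proof.
move=> intf intg.
have [mf _] := integrableP _ _ _ intf; have [mg _] := integrableP _ _ _ intg.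
have mfg : measurable_fun setT (EFin \o (fun p : T1 * T2 => f p.1 * g p.2)).
  apply/measurable_EFinP/measurable_funM.
    by apply: measurableT_comp; [exact/measurable_EFinP|exact: measurable_fst].
  by apply: measurableT_comp; [exact/measurable_EFinP|exact: measurable_snd].
apply/integrable12ltyP => //=.
have fA := integrable_fin_num measurableT (integrable_abse intf).
have gA := integrable_fin_num measurableT (integrable_abse intg).
rewrite (_ : (fun x => _) = (fun x => `|(f x)%:E| * \int[m2]_y `|(g y)%:E|)%E).
  rewrite ge0_integralZr//; [|exact: measurableT_comp|exact: integral_ge0].
  by rewrite -(fineK fA) -(fineK gA) -EFinM ltry.
apply/funext => x; rewrite -ge0_integralZl//.
  by apply: eq_integral => y _; rewrite -abseM.
by apply: measurableT_comp.
Qed.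

Lemma Rintegral_tensor (f : T1 -> R) (g : T2 -> R) :
  m1.-integrable setT (EFin \o f) -> m2.-integrable setT (EFin \o g) ->
  \int[(m1 \x m2)%E]_p (f p.1 * g p.2) =
  (\int[m1]_x f x) * (\int[m2]_y g y).
Proof.
move=> intf intg.
have := integrable_tensor intf intg => intfg.
have gA := integrable_fin_num measurableT intg.
rewrite /Rintegral -(integral12_prod_meas1 intfg) -fineM; last 2 first.
- exact: integrable_fin_num intf.
- exact: gA.
congr fine; rewrite -[in RHS](fineK gA) -integralZr//.
apply: eq_integral => x _; rewrite /fubini_F/= (fineK gA) -integralZl//.
Qed.

End real_tensor.

Section complex_integral.
Local Open Scope complex_scope.
Context d (T : measurableType d) (R : realType).
Implicit Types (mu : {measure set T -> \bar R}) (f g : T -> R[i]).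

Definition cmeasurable f := measurable_fun setT (fun x => complex.Re (f x)) /\
  measurable_fun setT (fun x => complex.Im (f x)).

Definition cintegrable mu f :=
  mu.-integrable setT (EFin \o (fun x => complex.Re (f x))) /\
  mu.-integrable setT (EFin \o (fun x => complex.Im (f x))).

(** For the Lebesgue measure on row vectors this is [Cintegral]; an arbitrary measure
    is needed to treat R^(n+1) as the product of R and R^n. *)
Definition cint mu f : R[i] :=
  (\int[mu]_x complex.Re (f x)) +i* (\int[mu]_x complex.Im (f x)).

Lemma ReM (x y : R[i]) : complex.Re (x * y) =
  complex.Re x * complex.Re y - complex.Im x * complex.Im y.
Proof. by case: x y => ? ? []. Qed.

Lemma ImM (x y : R[i]) : complex.Im (x * y) =
  complex.Re x * complex.Im y + complex.Im x * complex.Re y.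
Proof. by case: x y => ? ? []. Qed.

Lemma cmeasurable_cst (z : R[i]) : cmeasurable (cst z).
Proof. by []. Qed.

Lemma cmeasurableM f g : cmeasurable f -> cmeasurable g ->
  cmeasurable (fun x => f x * g x).
Proof.
move=> [f1 f2] [g1 g2]; split.
  under eq_fun do rewrite ReM.
  by apply: measurable_funB; exact: measurable_funM.
under eq_fun do rewrite ImM.
by apply: measurable_funD; exact: measurable_funM.
Qed.

Lemma cmeasurable_prod (I : Type) (r : seq I) (F : I -> T -> R[i]) :
  (forall i, cmeasurable (F i)) -> cmeasurable (fun x => \prod_(i <- r) F i x).
Proof.
move=> mF; elim: r => [|i r IH].
  by under eq_fun do rewrite big_nil; exact: cmeasurable_cst.
by under eq_fun do rewrite big_cons; exact: cmeasurableM.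
Qed.

Lemma cintegrable_measurable mu f : cintegrable mu f -> cmeasurable f.
Proof.
by move=> [/measurable_int/measurable_EFinP ? /measurable_int/measurable_EFinP ?].
Qed.

Lemma cintegrable_real mu (f : T -> R) : mu.-integrable setT (EFin \o f) ->
  cintegrable mu (fun x => (f x)%:C).
Proof. by move=> intf; split => //=; exact: integrable0. Qed.

Lemma cint_real mu (f : T -> R) : cint mu (fun x => (f x)%:C) = (\int[mu]_x f x)%:C.
Proof. by rewrite /cint/= Rintegral_cst// mul0r. Qed.

End complex_integral.

Section complex_tensor.
Local Open Scope complex_scope.
Context d1 d2 (T1 : measurableType d1) (T2 : measurableType d2) (R : realType).
Variables (m1 : {sigma_finite_measure set T1 -> \bar R})
          (m2 : {sigma_finite_measure set T2 -> \bar R}).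

Lemma cintegrable_tensor (f : T1 -> R[i]) (g : T2 -> R[i]) :
  cintegrable m1 f -> cintegrable m2 g ->
  cintegrable (m1 \x m2)%E (fun p => f p.1 * g p.2).
Proof.
move=> [f1 f2] [g1 g2]; split.
  rewrite (funext (fun p => ReM (f p.1) (g p.2))).
  by have := integrableB measurableT (integrable_tensor f1 g1) (integrable_tensor f2 g2).
rewrite (funext (fun p => ImM (f p.1) (g p.2))).
by have := integrableD measurableT (integrable_tensor f1 g2) (integrable_tensor f2 g1).
Qed.

Lemma cint_tensor (f : T1 -> R[i]) (g : T2 -> R[i]) :
  cintegrable m1 f -> cintegrable m2 g ->
  cint (m1 \x m2)%E (fun p => f p.1 * g p.2) = cint m1 f * cint m2 g.
Proof.
move=> [f1 f2] [g1 g2].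
have reE : \int[(m1 \x m2)%E]_p complex.Re (f p.1 * g p.2) =
    complex.Re (cint m1 f * cint m2 g).
  rewrite (funext (fun p => ReM (f p.1) (g p.2))) ReM.
  rewrite (RintegralB measurableT (integrable_tensor f1 g1) (integrable_tensor f2 g2)).
  by rewrite (Rintegral_tensor f1 g1) (Rintegral_tensor f2 g2).
have imE : \int[(m1 \x m2)%E]_p complex.Im (f p.1 * g p.2) =
    complex.Im (cint m1 f * cint m2 g).
  rewrite (funext (fun p => ImM (f p.1) (g p.2))) ImM.
  rewrite (RintegralD measurableT (integrable_tensor f1 g2) (integrable_tensor f2 g1)).
  by rewrite (Rintegral_tensor f1 g2) (Rintegral_tensor f2 g1).
by rewrite [LHS]/cint reE imE; case: (_ * _).
Qed.

End complex_tensor.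

Section lebesgue_rV_tensor.
Local Open Scope complex_scope.
Variable R : realType.
Local Notation mu := (@lebesgue_measure R).

Let integrable_cons n (f : 'rV[R]_n.+1 -> R) : measurable_fun setT f ->
  (mu \x @lebesgue_rV R n)%E.-integrable setT (EFin \o (f \o @cons_rV R n)) ->
  (@lebesgue_rV R n.+1).-integrable setT (EFin \o f) /\
  \int[@lebesgue_rV R n.+1]_x f x =
  \int[(mu \x @lebesgue_rV R n)%E]_p f (cons_rV p).
Proof.
move=> mf intf; have mc := @measurable_cons_rV R n.
have mf' : measurable_fun setT (EFin \o f) by exact/measurable_EFinP.
split; first exact: (integrable_pushforward mc mf' intf).
by congr fine; exact: (integral_pushforward mc mf' intf).
Qed.

Let cintegrable_cons n (f : 'rV[R]_n.+1 -> R[i]) : cmeasurable f ->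
  cintegrable (mu \x @lebesgue_rV R n)%E (f \o @cons_rV R n) ->
  cintegrable (@lebesgue_rV R n.+1) f /\
  cint (@lebesgue_rV R n.+1) f =
  cint (mu \x @lebesgue_rV R n)%E (f \o @cons_rV R n).
Proof.
move=> [mf1 mf2] [/(integrable_cons mf1)[i1 e1] /(integrable_cons mf2)[i2 e2]].
by split => //; rewrite /cint e1 e2.
Qed.

(** The Lebesgue measure on R^(n+1) is the image of a product under [cons_rV], so
    Fubini's theorem splits off one coordinate at a time.  Working with complex
    integrals turns the exponential of a scalar product into such a product. *)
Lemma cint_prod_coord n (f : 'I_n -> R -> R[i]) :
  (forall j, cintegrable mu (f j)) ->
  cintegrable (@lebesgue_rV R n) (fun x => \prod_j f j (x ord0 j)) /\
  cint (@lebesgue_rV R n) (fun x => \prod_j f j (x ord0 j)) =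
  \prod_j cint mu (f j).
Proof.
elim: n f => [|n IH] f intf.
  have muT : @lebesgue_rV R 0 setT = 1%E by exact: diracT.
  have i1 : (@lebesgue_rV R 0).-integrable setT (EFin \o cst (1 : R)).
    apply/integrableP; split; first exact/measurable_EFinP/measurable_cst.
    rewrite (eq_integral (cst 1%:E)) => [|x _]; last by rewrite /= normr1.
    by rewrite integral_cst// mul1e [X in (X < _)%E]muT ltry.
  rewrite big_ord0; under eq_fun do rewrite big_ord0.
  split; first exact: (cintegrable_real i1).
  by rewrite (cint_real _ (cst 1)) Rintegral_cst// [X in fine X]muT mul1r.
have [it et] := IH (fun j => f (lift ord0 j)) (fun j => intf _).
have consE : (fun x : 'rV[R]_n.+1 => \prod_j f j (x ord0 j)) \o @cons_rV R n =
    (fun p => f ord0 p.1 * \prod_(j < n) f (lift ord0 j) (p.2 ord0 j)).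
  apply/funext => p /=; rewrite big_ord_recl cons_rV0; congr (_ * _).
  by apply: eq_bigr => j _; rewrite cons_rVS.
have [||ic ec] := @cintegrable_cons n (fun x => \prod_j f j (x ord0 j)) _ _.
- apply: cmeasurable_prod => j.
  have [m1 m2] := cintegrable_measurable (intf j).
  by split; [apply: measurableT_comp m1 _|apply: measurableT_comp m2 _];
    exact: measurable_coord.
- by rewrite consE; exact: (cintegrable_tensor (intf ord0) it).
split=> //; rewrite ec consE (cint_tensor (intf ord0) it) et.
by rewrite [RHS]big_ord_recl.
Qed.

End lebesgue_rV_tensor.

(** * Bandlimited functions on the line *)

Section sinc_squared.
Variable R : realType.
Local Notation mu := (@lebesgue_measure R).

(** The value at 0 is the one that makes the function continuous; then the
    identities below, which involve several scales b, hold at 0 as well. *)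
Definition sinc2 (b x : R) : R := if x == 0 then b ^+ 2 else (sin (b * x) / x) ^+ 2.

Lemma abs_sin_le (x : R) : `|sin x| <= `|x|.
Proof.
wlog x0 : x / 0 < x => [H|].
  case: (ltgtP x 0) => [xN|/H//|->]; last by rewrite sin0.
  by have := H (- x); rewrite sinN !normrN; apply; rewrite oppr_gt0.
have [|c _] := @MVT R sin cos 0 x x0.
  by apply: continuous_subspaceT; exact: continuous_sin.
rewrite sin0 !subr0 => ->; rewrite normrM ler_piMl//.
by rewrite ler_norml cos_geN1 cos_le1.
Qed.

Lemma sinc2_ge0 b x : 0 <= sinc2 b x.
Proof. by rewrite /sinc2; case: ifP => _; exact: sqr_ge0. Qed.

Lemma sinc2_le b x : sinc2 b x <= (b ^+ 2 + 1) / oneDsqr x.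
Proof.
have D0 : 0 < oneDsqr x by apply: lt_le_trans (oneDsqr_ge1 x).
rewrite ler_pdivlMr// /sinc2 /oneDsqr; case: eqVneq => [->|x0].
  by rewrite expr0n/= addr0 mulr1 lerDl.
rewrite mulrDr mulr1 lerD//.
- rewrite -[leLHS]real_normK ?num_real// -[leRHS]real_normK ?num_real//.
  by rewrite ler_pXn2r// normf_div ler_pdivrMr ?normr_gt0// -normrM abs_sin_le.
- by rewrite expr_div_n divfK ?sqrf_eq0.
Qed.

Lemma continuous_sinc2 b : continuous (sinc2 b).
Proof.
have cs y : {for y, continuous (fun x : R => sin (b * x))}.
  by apply: continuous_comp; [exact: mulrl_continuous|exact: continuous_sin].
move=> x; have [->|x0] := eqVneq x 0; last first.
  apply: (@cvg_trans _ ((fun y => (sin (b * y) / y) ^+ 2) @ x)).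
    apply: near_eq_cvg; near=> y.
    rewrite /sinc2 ifN//.
    near: y; exact: open_neq.
  rewrite /sinc2 (negbTE x0).
  apply: (@cvg_comp _ _ _ _ (fun z : R => z ^+ 2)); last exact: exprn_continuous.
  apply: cvgM; first exact: cs.
  by apply: cvgV => //; exact: cvg_id.
(* The continuous difference quotient g of x |-> sin (b x) at 0 has value b there, so
   that the kernel is g ^+ 2 on the whole line. *)
have /is_derive1_caratheodory[g [gE cg g0]] :
    is_derive (0 : R) 1 (fun x : R => sin (b * x)) b.
  have ds : is_derive (b * 0) 1 (@sin R) 1.
    by rewrite mulr0 -[X in is_derive _ _ _ X]cos0; exact: is_derive_sin.
  have db : is_derive (0 : R) 1 ( *%R b) b.
    apply/is_derive1_caratheodory; exists (cst b); split => [z||//].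
      by rewrite -mulrBr.
    exact: cst_continuous.
  by have := is_derive1_comp ds db; rewrite mul1r.
have -> : sinc2 b = (fun x => g x ^+ 2).
  apply/funext => y; rewrite /sinc2; case: eqVneq => [->|y0]; first by rewrite g0.
  by have := gE y; rewrite mulr0 sin0 !subr0 => ->; rewrite mulfK.
exact: (continuous_comp cg (@exprn_continuous _ 2 _)).
Unshelve. all: by end_near. Qed.

(** The known integral over the half line controls x >= 0, its reflection x <= 0. *)
Lemma integrable_oneDsqrV : mu.-integrable setT (EFin \o (fun x : R => (oneDsqr x)^-1)).
Proof.
pose h := (fun x : R => (oneDsqr x)^-1) \_ `[0, +oo[.
have D0 (x : R) : 0 <= (oneDsqr x)^-1 by rewrite invr_ge0 (le_trans _ (oneDsqr_ge1 _)).
have cD : continuous (fun x : R => (oneDsqr x)^-1).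
  by move=> x; exact: continuous_oneDsqrV.
have mD : measurable_fun setT (EFin \o (fun x : R => (oneDsqr x)^-1)).
  by apply/measurable_EFinP; exact: continuous_measurable_fun.
have inth : mu.-integrable setT (EFin \o h).
  rewrite -restrict_EFin; apply/(integrable_mkcond _ _).1 => //.
  apply/integrableP; split; first exact: measurable_funTS.
  under eq_integral do rewrite gee0_abs ?lee_fin//.
  by rewrite integral0y_oneDsqr ltry.
have N0 : -1 != 0 :> R by rewrite oppr_eq0 oner_eq0.
have inth' := integrable_affine 0 N0 inth.
apply: le_integrable (integrableD measurableT inth inth') => //= x _.
rewrite lee_fin.
have DN : oneDsqr (- x) = oneDsqr x by rewrite /oneDsqr sqrrN.
rewrite /h /affine mulN1r addr0 !patchE DN ger0_norm//.
case: (leP 0 x) => x0.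
  rewrite ifT ?inE/= ?in_itv/= ?andbT//.
  by case: ifP => _; rewrite ger0_norm ?addr0 ?addr_ge0// lerDl.
rewrite ifF; last by apply/negbTE; rewrite notin_setE/= in_itv/= andbT leNgt x0.
by rewrite ifT ?add0r ?ger0_norm// inE/= in_itv/= andbT oppr_ge0 ltW.
Qed.

Lemma integrable_sinc2 b : mu.-integrable setT (EFin \o sinc2 b).
Proof.
apply: le_integrable (integrableZl measurableT (b ^+ 2 + 1) integrable_oneDsqrV) => //.
  by apply/measurable_EFinP; apply: continuous_measurable_fun; exact: continuous_sinc2.
move=> x _ /=; rewrite lee_fin ger0_norm ?sinc2_ge0//.
by rewrite (le_trans (sinc2_le b x))// ler_norm.
Qed.

(** [sinc2 b x = b ^+ 2 * sinc2 1 (b * x)], and the change of variable costs a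
    factor |b|. *)
Lemma Rintegral_sinc2 b : \int[mu]_x sinc2 b x = `|b| * \int[mu]_x sinc2 1 x.
Proof.
have [->|b0] := eqVneq b 0.
  rewrite normr0 mul0r; under eq_Rintegral => x _.
    rewrite /sinc2 mul0r sin0 mul0r expr0n/= if_same; over.
  by rewrite Rintegral_cst// mul0r.
rewrite -(Rintegral_affine 0 b0 (integrable_sinc2 1)) mulrA.
rewrite -normrM -expr2 ger0_norm ?sqr_ge0//.
rewrite -RintegralZl//; last exact: (integrable_affine 0 b0 (integrable_sinc2 1)).
apply: eq_Rintegral => x _; rewrite /sinc2 /affine addr0 mulf_eq0 (negbTE b0)/= mul1r.
case: eqVneq => x0; first by rewrite expr1n mulr1.
by field; rewrite x0 b0.
Qed.

End sinc_squared.

Section bandlimited_line.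
Variable R : realType.
Local Notation mu := (@lebesgue_measure R).
Implicit Types (phi psi : R -> R) (theta gamma : R).

Lemma continuous_cos_affine theta gamma : continuous (fun x : R => cos (theta * x + gamma)).
Proof.
move=> x; apply: (@continuous_comp _ _ _ (fun y => theta * y + gamma) cos).
  by apply: cvgD; [exact: mulrl_continuous|exact: cvg_cst].
exact: continuous_cos.
Qed.

Lemma integrable_mul_bounded phi psi (M : R) : mu.-integrable setT (EFin \o phi) ->
  measurable_fun setT psi -> (forall x, `|psi x| <= M) ->
  mu.-integrable setT (EFin \o (fun x => phi x * psi x)).
Proof.
move=> intf mpsi bpsi.
have mphi : measurable_fun setT phi by apply/measurable_EFinP; have := measurable_int _ intf.
apply: le_integrable (integrableZl measurableT M intf) => //.
  by apply/measurable_EFinP; exact: measurable_funM.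
move=> x _ /=; rewrite lee_fin !normrM mulrC ler_wpM2r//.
by rewrite (le_trans (bpsi x))// ler_norm.
Qed.

Lemma integrable_mul_cos phi theta gamma : mu.-integrable setT (EFin \o phi) ->
  mu.-integrable setT (EFin \o (fun x => phi x * cos (theta * x + gamma))).
Proof.
move=> intf; apply: (@integrable_mul_bounded _ _ 1) => //.
- by apply: continuous_measurable_fun; exact: continuous_cos_affine.
- by move=> x; exact: cos_max.
Qed.

(** The frequency is theta = 2 pi xi, so that pi < |theta| means |xi| > 1/2.  Asking
    for every phase gamma covers both the cosine and the sine transform and makes
    the class visibly stable under translation. *)
Definition bandlimited_line phi := [/\ continuous phi,
  exists M : R, forall x, `|phi x| <= M,
  mu.-integrable setT (EFin \o phi) &
  forall theta gamma, pi < `|theta| ->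
    \int[mu]_x (phi x * cos (theta * x + gamma)) = 0].

Lemma bandlimited_line_shift phi c : bandlimited_line phi ->
  bandlimited_line (fun x => phi (x + c)).
Proof.
move=> [cphi [M bphi] iphi vphi].
have shiftE x : phi (x + c) = phi (affine 1 c x) by rewrite /affine mul1r.
have n1 : (1 : R) != 0 by [].
split.
- move=> x; apply: (@continuous_comp _ _ _ (fun y => y + c)); last exact: cphi.
  by apply: cvgD; [exact: cvg_id|exact: cvg_cst].
- by exists M => x; exact: bphi.
- under [X in _ \o X]eq_fun do rewrite shiftE.
  exact: (integrable_affine c n1 iphi).
move=> theta gamma theta_pi.
have := Rintegral_affine c n1 (integrable_mul_cos theta (gamma - theta * c) iphi).
rewrite vphi// normr1 mul1r => <-; apply: eq_Rintegral => x _.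
by rewrite shiftE; congr (_ * cos _); rewrite /affine; ring.
Qed.

Lemma bandlimited_line_comb phi psi k : bandlimited_line phi -> bandlimited_line psi ->
  bandlimited_line (fun x => phi x + k * psi x).
Proof.
move=> [cphi [M bphi] iphi vphi] [cpsi [N bpsi] ipsi vpsi].
have ikpsi : mu.-integrable setT (EFin \o (fun x => k * psi x)).
  exact: (integrableZl measurableT k ipsi).
split.
- move=> x; apply: cvgD; first exact: cphi.
  by apply: cvgM; [exact: cvg_cst|exact: cpsi].
- exists (M + `|k| * N) => x; rewrite (le_trans (ler_normD _ _))// lerD//.
  by rewrite normrM ler_wpM2l.
- exact: (integrableD measurableT iphi ikpsi).
move=> theta gamma tp.
under eq_Rintegral do rewrite mulrDl -mulrA.
have ip := integrable_mul_cos theta gamma iphi.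
have iq := integrable_mul_cos theta gamma ipsi.
rewrite RintegralD//; last exact: (integrableZl measurableT k iq).
by rewrite RintegralZl// vphi// vpsi// mulr0 addr0.
Qed.

(** sin^2 A cos 2B = (sin^2 (A + B) + sin^2 (A - B)) / 2 - sin^2 B *)
Let sinc2_cosE (b a x : R) : sinc2 b x * cos (a *+ 2 * x) =
  2^-1 * sinc2 (b + a) x + 2^-1 * sinc2 (b - a) x - sinc2 a x.
Proof.
rewrite /sinc2; case: eqVneq => [->|x0]; first by rewrite mulr0 cos0; field.
rewrite mulrnAl cos_mulr2n mulrDl mulrBl sinD sinB.
have := cos2sin2 (b * x); have := cos2sin2 (a * x).
set S := sin _; set C := cos _; set s := sin _; set c := cos _ => c2 C2.
rewrite [RHS](_ : _ = (s ^+ 2 * C ^+ 2 + c ^+ 2 * S ^+ 2 - S ^+ 2) / x ^+ 2).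
  by rewrite c2 C2; field.
by field.
Qed.

(** By the previous identity and scaling, the cosine transform at theta = 2 a is
    proportional to |b + a| / 2 + |b - a| / 2 - |a|, which is 0 as soon as |a| >= b;
    the sine transform of an even function vanishes. *)
Lemma bandlimited_line_sinc2 : bandlimited_line (sinc2 (pi / 2)).
Proof.
have pi2 : 0 < pi / 2 :> R by rewrite divr_gt0// pi_gt0.
split.
- exact: continuous_sinc2.
- exists ((pi / 2) ^+ 2 + 1) => x; rewrite ger0_norm ?sinc2_ge0//.
  rewrite (le_trans (sinc2_le _ _))// ler_pdivrMr ?(lt_le_trans _ (oneDsqr_ge1 _))//.
  by rewrite ler_peMr// ?oneDsqr_ge1// addr_ge0// sqr_ge0.
- exact: integrable_sinc2.
move=> theta gamma tp.
set b := pi / 2; pose a := theta / 2.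
have ib := integrable_sinc2 b.
have even0 : \int[mu]_x (sinc2 b x * cos (theta * x)) = 0.
  rewrite (_ : theta = a *+ 2); last by rewrite /a -mulr_natr divfK.
  under eq_Rintegral do rewrite sinc2_cosE.
  have i1 := integrableZl measurableT 2^-1 (integrable_sinc2 (b + a)).
  have i2 := integrableZl measurableT 2^-1 (integrable_sinc2 (b - a)).
  have i3 := integrable_sinc2 a.
  rewrite RintegralB//; last exact: (integrableD measurableT i1 i2).
  rewrite RintegralD// !RintegralZl//; last 2 first.
  - exact: integrable_sinc2.
  - exact: integrable_sinc2.
  rewrite (Rintegral_sinc2 (b + a)) (Rintegral_sinc2 (b - a)) (Rintegral_sinc2 a).
  rewrite !mulrA -mulrDl -mulrBl.
  rewrite (_ : _ - `|a| = 0) ?mul0r//.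
  have : b < `|a| by rewrite /a /b normrM (ger0_norm (_ : 0 <= 2^-1)) ?ltr_pM2r.
  have b0 : 0 < b by exact: pi2.
  case: (lerP 0 a) => a0 ba.
    have ab : b < a by rewrite -(ger0_norm a0).
    rewrite (ger0_norm a0) (@gtr0_norm _ (b + a)) ?(@ltr0_norm _ (b - a)); lra.
  have ab : b < - a by rewrite -(ltr0_norm a0).
  rewrite (ltr0_norm a0) (@ltr0_norm _ (b + a)) ?(@gtr0_norm _ (b - a)); lra.
have i1 : mu.-integrable setT (EFin \o (fun x => sinc2 b x * sin (theta * x))).
  rewrite (_ : (fun x => _) =
      (fun x => sinc2 b x * cos (theta * x + - (pi / 2)))).
    exact: integrable_mul_cos.
  by apply/funext => x; rewrite cosBpihalf.
have odd0 : \int[mu]_x (sinc2 b x * sin (theta * x)) = 0.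
  have N0 : -1 != 0 :> R by rewrite oppr_eq0 oner_eq0.
  have := Rintegral_affine 0 N0 i1.
  rewrite normrN1 mul1r.
  under [X in X = _ -> _]eq_Rintegral => x _.
    rewrite /affine addr0 mulN1r mulrN sinN mulrN.
    rewrite (_ : sinc2 b (- x) = sinc2 b x); last first.
      by rewrite /sinc2 oppr_eq0 mulrN sinN invrN mulrNN.
    rewrite -mulN1r; over.
  by rewrite RintegralZl// => h; lra.
have ic : mu.-integrable setT (EFin \o (fun x => sinc2 b x * cos (theta * x))).
  have := integrable_mul_cos theta 0 ib.
  by under eq_fun do rewrite addr0.
under eq_Rintegral do rewrite cosD mulrBr !mulrA.
rewrite RintegralB//.
- by rewrite !RintegralZr// even0 odd0 !mul0r subr0.
- exact: (integrableZr measurableT _ ic).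
- exact: (integrableZr measurableT _ i1).
Qed.

End bandlimited_line.

(** * Tensor products of bandlimited functions *)

Section fourier_line.
Local Open Scope complex_scope.
Variable R : realType.
Local Notation mu := (@lebesgue_measure R).
Implicit Types (phi : R -> R) (xi : R).

Definition fourier_line phi xi : R[i] :=
  cint mu (fun x => (phi x)%:C * cis (- (2 * pi * (x * xi)))).

Let Re_realM (a : R) (z : R[i]) : complex.Re (a%:C * z) = a * complex.Re z.
Proof. by rewrite ReM /= mul0r subr0. Qed.

Let Im_realM (a : R) (z : R[i]) : complex.Im (a%:C * z) = a * complex.Im z.
Proof. by rewrite ImM /= mul0r addr0. Qed.

Let Re_kernelE phi xi : (fun x => complex.Re ((phi x)%:C * cis (- (2 * pi * (x * xi))))) =
  (fun x => phi x * cos (- (2 * pi * xi) * x + 0)).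
Proof.
by apply/funext => x; rewrite Re_realM /=; congr (_ * cos _); ring.
Qed.

Let Im_kernelE phi xi : (fun x => complex.Im ((phi x)%:C * cis (- (2 * pi * (x * xi))))) =
  (fun x => phi x * cos (- (2 * pi * xi) * x + - (pi / 2))).
Proof.
apply/funext => x; rewrite Im_realM /= -cosBpihalf; congr (_ * cos _); ring.
Qed.

Lemma cintegrable_fourier_line phi xi : mu.-integrable setT (EFin \o phi) ->
  cintegrable mu (fun x => (phi x)%:C * cis (- (2 * pi * (x * xi)))).
Proof.
move=> iphi; split; first by rewrite Re_kernelE; exact: integrable_mul_cos.
by rewrite Im_kernelE; exact: integrable_mul_cos.
Qed.

Let ReE phi xi : complex.Re (fourier_line phi xi) =
  \int[mu]_x (phi x * cos (- (2 * pi * xi) * x + 0)).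
Proof. by rewrite /fourier_line/cint Re_kernelE. Qed.

Let ImE phi xi : complex.Im (fourier_line phi xi) =
  \int[mu]_x (phi x * cos (- (2 * pi * xi) * x + - (pi / 2))).
Proof. by rewrite /fourier_line/cint Im_kernelE. Qed.

Lemma fourier_line_eq0 phi xi : bandlimited_line phi -> 2^-1 < `|xi| ->
  fourier_line phi xi = 0.
Proof.
move=> [_ _ _ vphi] xi2.
have pixi : pi < `|- (2 * pi * xi)|.
  rewrite normrN !normrM (ger0_norm (pi_ge0 R)) ger0_norm// mulrAC.
  by rewrite ltr_pMl ?pi_gt0//; lra.
apply/eqP; rewrite eq_complex ReE ImE !vphi//.
by rewrite !eqxx.
Qed.

Let continuous_cos_integral phi gamma : mu.-integrable setT (EFin \o phi) ->
  continuous (fun xi => \int[mu]_x (phi x * cos (- (2 * pi * xi) * x + gamma))).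
Proof.
move=> iphi xi.
have iabs : mu.-integrable setT (EFin \o (fun x => `|phi x|)).
  exact: integrable_abse iphi.
pose F (z x : R) := phi x * cos (- (2 * pi * z) * x + gamma).
have iF z : `]xi - 1, xi + 1[%classic z -> mu.-integrable setT (EFin \o F z).
  by move=> _; exact: integrable_mul_cos.
have cF : {ae mu, forall y, setT y -> {in `]xi - 1, xi + 1[%classic, continuous (F^~ y)}}.
  apply: aeW => y _ z _.
  apply: cvgM; first exact: cvg_cst.
  apply: (@continuous_comp _ _ _ (fun z => - (2 * pi * z) * y + gamma) cos).
    apply: cvgD; last exact: cvg_cst.
    apply: cvgM; last exact: cvg_cst.
    by apply: cvgN; apply: cvgM; [exact: cvg_cst|exact: cvg_id].
  exact: continuous_cos.
have bF z : `]xi - 1, xi + 1[%classic z ->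
    {ae mu, forall y, setT y -> `|F z y| <= `|phi y|}.
  by move=> _; apply: aeW => y _; rewrite normrM ler_piMr// cos_max.
apply: (continuity_under_integral measurableT iF cF iabs bF).
by rewrite inE/= in_itv/=; apply/andP; split; lra.
Qed.

Let integrable_compact_support (u : R -> R) : continuous u ->
  (forall xi, 2^-1 < `|xi| -> u xi = 0) -> mu.-integrable setT (EFin \o u).
Proof.
move=> cu u0.
have := @continuous_compact_integrable R u `[- 2^-1, 2^-1] (@segment_compact R _ _)
  (continuous_subspaceT cu).
move/(integrable_mkcond _ _).1 => /(_ (measurable_itv _)).
rewrite restrict_EFin (_ : u \_ _ = u)//; apply/funext => x; rewrite patchE.
case: ifPn => // /negP; rewrite inE/= in_itv/= -ler_norml => /negP.
by rewrite -ltNge => /u0.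
Qed.

(** The transform is continuous by dominated convergence, and supported in
    [-1/2, 1/2]. *)
Lemma cintegrable_fourier_line_freq phi : bandlimited_line phi ->
  cintegrable mu (fourier_line phi).
Proof.
move=> bphi; have [_ _ iphi _] := bphi.
have continuous_Re : continuous (fun xi => complex.Re (fourier_line phi xi)).
  exact: (eq_ind_r (fun f : R -> R => continuous f)
    (@continuous_cos_integral phi 0 iphi) (funext (ReE phi))).
have continuous_Im : continuous (fun xi => complex.Im (fourier_line phi xi)).
  exact: (eq_ind_r (fun f : R -> R => continuous f)
    (@continuous_cos_integral phi (- (pi / 2)) iphi) (funext (ImE phi))).
split; apply: integrable_compact_support.
- exact: continuous_Re.
- by move=> xi /(fourier_line_eq0 bphi) ->.
- exact: continuous_Im.
- by move=> xi /(fourier_line_eq0 bphi) ->.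
Qed.

Lemma integrable_sqr_fourier_line phi : bandlimited_line phi ->
  mu.-integrable setT (EFin \o (fun xi => ComplexField.Normc.normc (fourier_line phi xi) ^+ 2)).
Proof.
move=> bphi; have [_ _ iphi _] := bphi.
have sqE xi : ComplexField.Normc.normc (fourier_line phi xi) ^+ 2 =
    complex.Re (fourier_line phi xi) ^+ 2 + complex.Im (fourier_line phi xi) ^+ 2.
  by case: (fourier_line phi xi) => a b /=; rewrite sqr_sqrtr// addr_ge0// sqr_ge0.
apply: integrable_compact_support => [|xi xi2]; last first.
  by rewrite sqE fourier_line_eq0// expr0n addr0.
rewrite (_ : (fun xi => _) = (fun xi =>
    (\int[mu]_x (phi x * cos (- (2 * pi * xi) * x + 0))) ^+ 2 +
    (\int[mu]_x (phi x * cos (- (2 * pi * xi) * x + - (pi / 2)))) ^+ 2)); last first.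
  by apply/funext => xi; rewrite sqE ReE ImE.
move=> xi.
apply: cvgD; apply: (@cvg_comp _ _ _ _ (fun z : R => z ^+ 2));
  [exact: continuous_cos_integral|exact: exprn_continuous|
   exact: continuous_cos_integral|exact: exprn_continuous].
Qed.

End fourier_line.

Section tensor.
Local Open Scope complex_scope.
Variables (R : realType) (n : nat).
Local Notation mu := (@lebesgue_measure R).
Local Notation leb := (@lebesgue_rV R n).
Local Notation normc := (@ComplexField.Normc.normc R).
Implicit Types (phi : 'I_n -> R -> R).

Lemma Rintegral_prod_coord (u : 'I_n -> R -> R) :
  (forall j, mu.-integrable setT (EFin \o u j)) ->
  leb.-integrable setT (EFin \o (fun x => \prod_j u j (x ord0 j))) /\
  \int[leb]_x (\prod_j u j (x ord0 j)) = \prod_j \int[mu]_t u j t.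
Proof.
move=> iu.
have [[+ _] e] := cint_prod_coord (fun j => cintegrable_real (iu j)).
have prodE (x : 'rV[R]_n) : \prod_j (u j (x ord0 j))%:C = (\prod_j u j (x ord0 j))%:C.
  by rewrite rmorph_prod.
under eq_fun do rewrite prodE.
move=> i; split => //; move: e.
under eq_fun do rewrite prodE.
rewrite cint_real; under eq_bigr do rewrite cint_real.
by rewrite -rmorph_prod => -[].
Qed.

Lemma poweR2 (x : \bar R) : (0 <= x)%E -> (x `^ 2 = x ^+ 2)%E.
Proof.
case: x => [r|_|//]; last by rewrite poweRyr ?pnatr_eq0// expe2 mulyy.
by rewrite lee_fin poweR_EFin => r0; rewrite powR_mulrn// expe2 -EFinM -expr2.
Qed.

Lemma sqr_LpnormC2 (f : 'rV[R]_n -> R[i]) :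
  (LpnormC 2 f ^+ 2 = \int[leb]_x (normc (f x) ^+ 2)%:E)%E.
Proof.
rewrite -poweR2 ?Lnorm_ge0// /LpnormC poweR_Lnorm ?pnatr_eq0//.
apply: eq_integral => x _; rewrite poweR2// expe2 -abseM -EFinM -expr2.
by rewrite gee0_abs// lee_fin sqr_ge0.
Qed.

Lemma LpC2_intro (f : 'rV[R]_n -> R[i]) : cmeasurable f ->
  leb.-integrable setT (EFin \o (fun x => normc (f x) ^+ 2)) -> LpC 2 f.
Proof.
move=> [m1 m2] /integrableP[_]; under eq_integral do rewrite gee0_abs ?lee_fin ?sqr_ge0//.
move=> foo; split => //; apply: (@lty_poweRy _ _ 2); first by rewrite pnatr_eq0.
by rewrite poweR2 ?Lnorm_ge0// sqr_LpnormC2.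
Qed.

Definition tensor phi (x : 'rV[R]_n) : R[i] := (\prod_j phi j (x ord0 j))%:C.

Lemma normc_tensor phi x : normc (tensor phi x) = `|\prod_j phi j (x ord0 j)|.
Proof. by rewrite /tensor/= expr0n addr0 sqrtr_sqr. Qed.

Lemma fourier_integral_tensor phi xi :
  (forall j, mu.-integrable setT (EFin \o phi j)) ->
  fourier_integral (tensor phi) xi = \prod_j fourier_line (phi j) (xi ord0 j).
Proof.
move=> iphi.
have [_ <-] := cint_prod_coord (fun j => cintegrable_fourier_line (xi ord0 j) (iphi j)).
rewrite /fourier_integral -[LHS]/(cint _ _); congr cint; apply/funext => x.
rewrite big_split/=; congr (_ * _); first by rewrite /tensor rmorph_prod.
rewrite /dotr mulr_sumr -sumrN.
have cisD (s t : R) : cis (s + t) = cis s * cis t.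
  by apply/eqP; rewrite eq_complex ReM ImM /= cosD sinD (addrC (sin s * _)) !eqxx.
have cis0 : cis (0 : R) = 1 by rewrite /cis cos0 sin0.
by rewrite (big_morph _ cisD cis0).
Qed.

Lemma continuous_tensor phi : (forall j, continuous (phi j)) ->
  continuous (tensor phi : 'rV[R]_n -> (R[i] : numFieldType)).
Proof.
move=> cphi.
have cprod : continuous (fun x : 'rV[R]_n => \prod_j phi j (x ord0 j)).
  have cr (r : seq 'I_n) : continuous (fun x : 'rV[R]_n => \prod_(j <- r) phi j (x ord0 j)).
    elim: r => [|j r IH].
      rewrite (_ : (fun _ => _) = cst 1); first exact: cst_continuous.
      by apply/funext => x; rewrite big_nil.
    rewrite (_ : (fun _ => _) = (fun x : 'rV[R]_n =>
        phi j (x ord0 j) * \prod_(j <- r) phi j (x ord0 j))); last first.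
      by apply/funext => x; rewrite big_cons.
    move=> x.
    have cc := @coord_continuous R 1 n ord0 j x.
    exact: (cvgM (continuous_comp cc (cphi j _)) (IH x)).
  exact: cr.
move=> x; apply/cvgrPdist_lt; first exact: (nbhs_filter x).
move=> e e0.
have eE : e = (complex.Re e)%:C.
  by move: e0; case: (e) => a b; rewrite ltcE /= => /andP[/eqP -> _].
rewrite eE; have e0' : 0 < complex.Re e by rewrite -ltcR -eE.
have /cvgrPdist_lt /(_ _ e0') := cprod x; apply: filterS => y.
by rewrite /tensor -rmorphB/= normc_def/= expr0n addr0 sqrtr_sqr ltcR.
Qed.

Lemma integrable_sqr_bandlimited_line (phi : R -> R) : bandlimited_line phi ->
  mu.-integrable setT (EFin \o (fun x => phi x ^+ 2)).
Proof.
move=> [cphi [M bphi] iphi _].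
exact: (integrable_mul_bounded iphi (continuous_measurable_fun cphi) bphi).
Qed.

Lemma sqr_norm_tensor phi : (forall j, bandlimited_line (phi j)) ->
  (LpnormC 2 (tensor phi) ^+ 2 = (\prod_j \int[mu]_x phi j x ^+ 2)%:E)%E.
Proof.
move=> bphi.
have [i e] := Rintegral_prod_coord (fun j => integrable_sqr_bandlimited_line (bphi j)).
rewrite sqr_LpnormC2 -e /Rintegral fineK; last exact: integrable_fin_num i.
apply: eq_integral => x _.
by rewrite normc_tensor real_normK ?num_real// prodrXl.
Qed.

(** The function is in L^1 and L^2, hence it is its own approximating sequence and
    its transform is the Fourier integral, which is the product of the transforms
    in each variable: it vanishes on the open set where one given frequency exceeds
    1/2, and these sets cover the complement of the cube. *)
Lemma bandlimited_tensor phi : (forall j, bandlimited_line (phi j)) ->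
  bandlimited (tensor phi).
Proof.
move=> bphi.
have iphi j : mu.-integrable setT (EFin \o phi j) by have [] := bphi j.
have cphi j : continuous (phi j) by have [] := bphi j.
split; first exact: continuous_tensor.
pose F (xi : 'rV[R]_n) := \prod_j fourier_line (phi j) (xi ord0 j).
have mtensor : cmeasurable (tensor phi).
  have [i _] := Rintegral_prod_coord iphi.
  exact: cintegrable_measurable (cintegrable_real i).
have L2t : LpC 2 (tensor phi).
  apply: LpC2_intro => //.
  have [i _] := Rintegral_prod_coord (fun j => integrable_sqr_bandlimited_line (bphi j)).
  have E x : normc (tensor phi x) ^+ 2 = \prod_j phi j (x ord0 j) ^+ 2.
    by rewrite normc_tensor real_normK ?num_real// prodrXl.
  by rewrite (funext E).
have L1t : LpC 1 (tensor phi).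
  have [m1 m2] := mtensor; split=> //.
  have [/integrable_abse/integrableP[_ +] _] := Rintegral_prod_coord iphi.
  rewrite /LpnormC Lnorm1; apply: le_lt_trans.
  rewrite le_eqVlt; apply/orP; left; apply/eqP; apply: eq_integral => x _.
  rewrite abse_id -[LHS]/(`|(normc (tensor phi x))%:E|)%E normc_tensor.
  by rewrite /= normr_id.
have L2F : LpC 2 F.
  have [i _] := cint_prod_coord (fun j => cintegrable_fourier_line_freq (bphi j)).
  apply: LpC2_intro; first exact: cintegrable_measurable i.
  have [i2 _] := Rintegral_prod_coord (fun j => integrable_sqr_fourier_line (bphi j)).
  have E xi : normc (F xi) ^+ 2 =
      \prod_j normc (fourier_line (phi j) (xi ord0 j)) ^+ 2.
    rewrite prodrXl /F; congr (_ ^+ 2).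
    by rewrite (big_morph _ (@ComplexField.Normc.normcM R) (ComplexField.Normc.normc1 R)).
  by rewrite (funext E).
have norm0 (f : 'rV[R]_n -> R[i]) : f =1 cst 0 -> LpnormC 2 f = 0%E.
  move=> f0; rewrite /LpnormC (@eq_Lnorm _ _ _ _ _ _ (cst 0%E)).
    by rewrite Lnorm0// eqe pnatr_eq0.
  by move=> x /=; rewrite f0 /= expr0n addr0 sqrtr0.
exists F.
  split=> //; exists (fun=> tensor phi); split => //.
  - apply: cvg_near_cst; apply: nearW => k; apply: norm0 => x.
    by rewrite subrr.
  - apply: cvg_near_cst; apply: nearW => k; apply: norm0 => x.
    by rewrite fourier_integral_tensor// subrr.
move=> xi xiF j; apply: contrapT => /negP; rewrite -ler_norml -ltNge => xij; apply: xiF.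
exists [set x : 'rV[R]_n | 2^-1 < `|x ord0 j|]; last exact: xij.
split.
  apply: (@open_comp _ _ (fun x : 'rV[R]_n => `|x ord0 j|) [set y | 2^-1 < y]).
    move=> x _; apply: (@continuous_comp _ _ _ (fun x : 'rV[R]_n => x ord0 j) Num.norm).
      exact: coord_continuous.
    exact: norm_continuous.
  exact: open_gt.
apply: aeW => x /= xj; rewrite /F (bigD1 j)//= fourier_line_eq0// mul0r//.
Qed.

End tensor.

(** * Large holes are incompatible with the sampling inequality *)

Section sinc_comparison.
Variable R : realType.
Local Notation mu := (@lebesgue_measure R).

Let s : R -> R := sinc2 (pi / 2).

(** The coefficient 1 and the shift -1 match the form of the closure lemmas for
   [bandlimited_line]. *)
Definition sinc_sum (x : R) : R := s (x + 1) + 1 * s (x + -1).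
Definition sinc_diff (x : R) : R := s (x + 1) + -1 * s (x + -1).

Lemma bandlimited_sinc_sum : bandlimited_line sinc_sum.
Proof.
by apply: bandlimited_line_comb; apply: bandlimited_line_shift;
  exact: bandlimited_line_sinc2.
Qed.

Lemma bandlimited_sinc_diff : bandlimited_line sinc_diff.
Proof.
by apply: bandlimited_line_comb; apply: bandlimited_line_shift;
  exact: bandlimited_line_sinc2.
Qed.

Lemma sinc_sum_ge0 x : 0 <= sinc_sum x.
Proof. by rewrite /sinc_sum mul1r addr_ge0// sinc2_ge0. Qed.

Lemma sinc_diff_le_sum x : `|sinc_diff x| <= sinc_sum x.
Proof.
rewrite /sinc_diff /sinc_sum mul1r mulN1r (le_trans (ler_normB _ _))//.
by rewrite !ger0_norm ?sinc2_ge0.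
Qed.

Let sinc2_sqr (b x : R) : sinc2 b x * x ^+ 2 = sin (b * x) ^+ 2.
Proof.
rewrite /sinc2; case: eqVneq => [->|x0]; first by rewrite mulr0 sin0 !expr0n mulr0.
by field.
Qed.

(** As sin (pi (x + 1) / 2) = - sin (pi (x - 1) / 2), the kernels u at x + 1 and v
    at x - 1 satisfy u (x + 1)^2 = v (x - 1)^2, which can be rearranged into
    (u - v) (x^2 + 1) = - 2 x (u + v). *)
Lemma sinc_diff_decay x : `|x| * `|sinc_diff x| <= 2 * sinc_sum x.
Proof.
rewrite /sinc_diff /sinc_sum mul1r mulN1r.
set u := s (x + 1); set v := s (x + -1).
have u0 : 0 <= u by exact: sinc2_ge0.
have v0 : 0 <= v by exact: sinc2_ge0.
have uv : u * (x + 1) ^+ 2 = v * (x + -1) ^+ 2.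
  rewrite /u /v /s !sinc2_sqr.
  rewrite (_ : pi / 2 * (x + 1) = pi / 2 * (x + -1) + pi); last by field.
  by rewrite sinDpi sqrrN.
have key : (u - v) * (x ^+ 2 + 1) = - 2 * x * (u + v) by lra.
have D0 : 0 < x ^+ 2 + 1 by rewrite ltr_wpDl// sqr_ge0.
rewrite -(ler_pM2r D0) -mulrA -{1}(gtr0_norm D0) -normrM key.
rewrite !normrM normrN (ger0_norm (addr_ge0 u0 v0)) (ger0_norm (_ : 0 <= 2))//.
have := real_normK (num_real x).
have : 0 <= u + v by rewrite addr_ge0.
nra.
Qed.

(** The function is continuous and takes the value (pi / 2)^2 at -1, where the other
    kernel vanishes. *)
Lemma Rintegral_sqr_sinc_diff_gt0 : 0 < \int[mu]_x sinc_diff x ^+ 2.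
Proof.
have [cd _ _ _] := bandlimited_sinc_diff.
pose b : R := pi / 2.
have b0 : 0 < b by rewrite divr_gt0// pi_gt0.
have dN1 : sinc_diff (-1) = b ^+ 2.
  rewrite /sinc_diff addNr /s {1}/sinc2 eqxx mulN1r /sinc2 ifF; last by apply/negbTE; lra.
  rewrite (_ : pi / 2 * (-1 + -1) = - pi); last by field.
  by rewrite sinN sinpi oppr0 mul0r expr0n subr0.
have h0 : 0 < b ^+ 2 / 2 by rewrite divr_gt0// exprn_gt0.
have /nbhs_ballP[e /= e0 he] : \forall x \near (-1 : R), b ^+ 2 / 2 < sinc_diff x.
  by have /cvgr_gt := cd (-1); apply; rewrite dN1; lra.
have mball := @measurable_ball R (-1) e.
have isq := integrable_sqr_bandlimited_line bandlimited_sinc_diff.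
rewrite -lte_fin /Rintegral fineK; last exact: integrable_fin_num isq.
have h1 : (0 < \int[mu]_(x in ball ((-1)%R : R) e) ((b ^+ 2 / 2) ^+ 2)%:E)%E.
  rewrite integral_cst// [X in (_ * X)%E](_ : _ = (e *+ 2)%:E); last first.
    by apply: lebesgue_measure_ball; exact: ltW.
  by rewrite -EFinM lte_fin mulr_gt0 ?exprn_gt0// mulrn_wgt0.
apply: (lt_le_trans h1).
have h2 : (\int[mu]_(x in ball ((-1)%R : R) e) ((b ^+ 2 / 2) ^+ 2)%:E <=
    \int[mu]_(x in ball ((-1)%R : R) e) (sinc_diff x ^+ 2)%:E)%E.
  apply: ge0_le_integral => //=.
  - by move=> x _; rewrite lee_fin sqr_ge0.
  - by apply: measurable_funTS; exact: measurable_int isq.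
  - move=> x /he h; rewrite lee_fin lerXn2r ?nnegrE//; last 2 first.
    + exact: ltW (lt_trans h0 h).
    + exact: ltW.
    + exact: ltW.
apply: (le_trans h2); apply: ge0_subset_integral => //.
  exact: measurable_int isq.
by move=> x _; rewrite lee_fin sqr_ge0.
Qed.

End sinc_comparison.

Lemma le_esumZl (R : realType) (T : choiceType) (S : set T) (k : R) (a : T -> \bar R) : 0 <= k ->
  (forall t, 0 <= a t)%E ->
  (\esum_(t in S) (k%:E * a t) <= k%:E * \esum_(t in S) a t)%E.
Proof.
move=> k0 a0; apply: ge_ereal_sup => _ [F FS <-].
rewrite -ge0_mule_fsumr//; apply: lee_wpmul2l; first by rewrite lee_fin.
by apply: ereal_sup_ubound; exists F.
Qed.

Section holes.
Variables (R : realType) (n : nat).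
Local Notation mu := (@lebesgue_measure R).
Local Notation Rn := 'rV[R]_n.
Local Notation normc := (@ComplexField.Normc.normc R).

Let translate (phi : R -> R) (c : Rn) (j : 'I_n) (t : R) : R := phi (t + - c ord0 j).

Let bandlimited_translate (phi : R -> R) (c : Rn) : bandlimited_line phi ->
  bandlimited (tensor (translate phi c)).
Proof. by move=> bphi; apply: bandlimited_tensor => j; exact: bandlimited_line_shift. Qed.

Let sqr_norm_translate (phi : R -> R) (c : Rn) : bandlimited_line phi ->
  (LpnormC 2 (tensor (translate phi c)) ^+ 2 = ((\int[mu]_x phi x ^+ 2) ^+ n)%:E)%E.
Proof.
move=> bphi; rewrite sqr_norm_tensor; last by move=> j; exact: bandlimited_line_shift.
congr EFin; rewrite -[n in RHS]card_ord -prodr_const; apply: eq_bigr => j _.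
have := Rintegral_affine (- c ord0 j) (oner_neq0 R) (integrable_sqr_bandlimited_line bphi).
rewrite normr1 mul1r => <-; apply: eq_Rintegral => x _.
by rewrite /affine mul1r.
Qed.

(** The decay is used in the coordinate j that is far from the center, the plain
   bound in all others. *)
Let diff_le_sum (K : R) (c y : Rn) (j : 'I_n) : 0 < K -> K <= `|y ord0 j - c ord0 j| ->
  normc (tensor (translate (@sinc_diff R) c) y) ^+ 2 <=
  (2 / K) ^+ 2 * normc (tensor (translate (@sinc_sum R) c) y) ^+ 2.
Proof.
move=> K0 Kyc.
have K20 : 0 <= 2 / K by rewrite divr_ge0// ltW.
rewrite -exprMn lerXn2r// ?nnegrE; [by rewrite normc_tensor|by rewrite mulr_ge0// normc_tensor|].
rewrite !normc_tensor [X in _ <= _ * X]ger0_norm; last first.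
  by apply: prodr_ge0 => i _; exact: sinc_sum_ge0.
rewrite normr_prod (bigD1 j)//= [in leRHS](bigD1 j)//= mulrA.
apply: ler_pM => //; first by apply: prodr_ge0.
  rewrite mulrAC ler_pdivlMr// mulrC; apply: le_trans (sinc_diff_decay _).
  by rewrite ler_wpM2r.
by apply: ler_prod => i _; rewrite normr_ge0 sinc_diff_le_sum.
Qed.

(** The point of comparing two bandlimited functions is that the upper sampling
    bound, applied to the larger one, controls the sum of the smaller one over the
    points far from c. *)
Lemma holes_sampling_fails (Y : set Rn) :
  (forall K : R, 0 < K -> exists c : Rn, forall y, Y y ->
     exists j, K <= `|y ord0 j - c ord0 j|) ->
  ~ sampling_inequality Y.
Proof.
move=> holes [A [B [A0 B0 AB]]].
pose a := (\int[mu]_x sinc_diff x ^+ 2) ^+ n.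
pose b := (\int[mu]_x sinc_sum x ^+ 2) ^+ n.
have a0 : 0 < a by rewrite exprn_gt0// Rintegral_sqr_sinc_diff_gt0.
have b0 : 0 <= b by rewrite exprn_ge0// Rintegral_ge0// => x _; exact: sqr_ge0.
pose K := 1 + 4 * B * b / (A * a).
have Aa0 : 0 < A * a by rewrite mulr_gt0.
have K1 : 1 <= K by rewrite lerDl; apply: divr_ge0; [rewrite !mulr_ge0// ltW|exact: ltW].
have K0 : 0 < K by exact: lt_le_trans K1.
have [c cK] := holes K K0.
have [lower _] := AB _ (bandlimited_translate c (bandlimited_sinc_diff R)).
have [_ upper] := AB _ (bandlimited_translate c (bandlimited_sinc_sum R)).
move: lower upper; rewrite !sqr_norm_translate;
  [|exact: bandlimited_sinc_sum|exact: bandlimited_sinc_diff].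
rewrite -/a -/b => lower upper.
have : ((A * a)%:E <= ((2 / K) ^+ 2 * (B * b))%:E)%E.
  rewrite EFinM (le_trans lower)//.
  apply: le_trans (_ : _ <= \esum_(y in Y) (((2 / K) ^+ 2)%:E *
     (normc (tensor (translate (@sinc_sum R) c) y) ^+ 2)%:E))%E _.
    apply: le_esum => y Yy; have [j Kj] := cK y Yy.
    by rewrite -EFinM lee_fin; exact: (diff_le_sum K0 Kj).
  apply: (le_trans (le_esumZl _ _ _)).
  - by rewrite sqr_ge0.
  - by move=> t; rewrite lee_fin sqr_ge0.
  - rewrite [leRHS]EFinM; apply: lee_wpmul2l; first by rewrite lee_fin sqr_ge0.
    by rewrite EFinM.
rewrite lee_fin leNgt => /negP; apply.
rewrite expr_div_n mulrAC ltr_pdivrMr ?exprn_gt0//.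
(* K is chosen for this: with K >= 1 it gives 4 B b < A a K <= A a K^2. *)
have KE : A * a * K = A * a + 4 * B * b by rewrite /K; field; rewrite !gt_eqF.
have : 0 <= B * b by rewrite mulr_ge0// ltW.
nra.
Qed.

End holes.

(** * Large holes of a Poisson process *)

Lemma counting_eq0 (R : realType) (T : choiceType) (A : set T) : counting A = 0%E :> \bar R -> A = set0.
Proof.
rewrite /counting; case: asboolP => // finA [/eqP].
by rewrite pnatr_eq0 finmap.cardfs_eq0 => /eqP/(fset_set_set0 finA).
Qed.

Section poisson_void.
Context d (Omega : measurableType d) (R : realType) (P : probability Omega R).
Variables (n : nat) (lambda : 'rV[R]_n -> R) (X : Omega -> set 'rV[R]_n).
Hypothesis lambda_ge0 : forall x, 0 <= lambda x.
Hypothesis X_poisson : poisson_process P lambda X.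
Local Notation leb := (@lebesgue_rV R n).

Let N (A : set 'rV[R]_n) (w : Omega) : \bar R := counting (X w `&` A).

Let measurable_hit A : measurable A -> measurable (N A @^-1` ~` [set 0%E]).
Proof.
move=> mA; have [mN _] := X_poisson.1 A mA.
rewrite -[X in measurable X]setTI; apply: mN => //.
by apply: measurableC; exact: emeasurable_set1.
Qed.

(** A Poisson variable with parameter q <= r is nonzero with probability
   1 - exp (- q) <= exp (- exp (- q)) <= exp (- exp (- r)). *)
Let hit_le A r : measurable A ->
  (\int[leb]_(x in A) (lambda x)%:E <= r%:E)%E ->
  (P (N A @^-1` ~` [set 0%E]) <= (expR (- expR (- r)))%:E)%E.
Proof.
move=> mA ler; have [mN] := X_poisson.1 A mA.
have fin : (\int[leb]_(x in A) (lambda x)%:E)%E \is a fin_num.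
  rewrite ge0_fin_numE ?(le_lt_trans ler)// ?ltry//.
  by apply: integral_ge0 => x _; rewrite lee_fin.
move: ler; rewrite -(fineK fin); set q := fine _ => qr /(_ 0%N).
rewrite expr0 mulr1 fact0 divr1 => PN.
rewrite -[X in P X]/(~` (N A @^-1` [set 0%E])).
rewrite probability_setC; last first.
  by rewrite -[X in measurable X]setTI; apply: mN => //; exact: emeasurable_set1.
rewrite PN -EFinB lee_fin (le_trans (expR_ge1Dx _))// ler_expR lerN2 ler_expR lerN2.
by rewrite -lee_fin.
Qed.

(** The second Borel-Cantelli argument: by independence, the probability that the
    first m sets are all hit is at most exp (- sum_(i < m) exp (- r i)). *)
Lemma ae_void (A : nat -> set 'rV[R]_n) (r : nat -> R) :
  (forall i, measurable (A i)) -> trivIset setT A ->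
  (forall i, (\int[leb]_(x in A i) (lambda x)%:E <= (r i)%:E)%E) ->
  series (fun i => expR (- r i)) @ \oo --> +oo ->
  {ae P, forall w, exists i, X w `&` A i = set0}.
Proof.
move=> mA tA intA diverge.
pose E := \bigcap_i (N (A i) @^-1` ~` [set 0%E]).
have mE : measurable E by apply: bigcapT_measurable => i; exact: measurable_hit.
exists E; split=> //; last first.
  move=> w /= h i _ /= NA; apply: h; exists i; exact: (counting_eq0 NA).
have PE m : (P E <= (expR (- series (fun i => expR (- r i)) m))%:E)%E.
  apply: (@le_trans _ _ (P (\bigcap_(i in [set: 'I_m]) (N (A i) @^-1` ~` [set 0%E])))).
    apply: le_measure; rewrite ?inE//.
      by apply: fin_bigcap_measurable => // i _; exact: measurable_hit.
    by move=> w Ew i _; exact: Ew.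
  have hE (i : 'I_m) : P (N (A i) @^-1` ~` [set 0%E]) =
      (fine (P (N (A i) @^-1` ~` [set 0%E])))%:E.
    by rewrite fineK// fin_num_measure//; exact: measurable_hit.
  rewrite (X_poisson.2 m (fun i => A i)) //; last 2 first.
  - apply/trivIsetP => i j _ _ ij.
    by move/trivIsetP : tA; apply.
  - by move=> i; apply: measurableC; exact: emeasurable_set1.
  rewrite (eq_bigr _ (fun i _ => hE i)) prodEFin lee_fin /series/= big_mkord -sumrN expR_sum.
  apply: ler_prod => i _; rewrite fine_ge0//= -lee_fin -hE.
  exact: hit_le.
apply/eqP; rewrite -measure_le0; apply/lee_addgt0Pr => e e0.
rewrite add0e.
have [m _ /(_ m (leqnn _)) /= hm] : \forall m \near \oo,
    - ln e <= series (fun i => expR (- r i)) m.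
  by move/cvgryPge : diverge; apply.
by rewrite (le_trans (PE m))// lee_fin -[leRHS](lnK (e0 : e \is Num.pos)) ler_expR lerNl.
Qed.

End poisson_void.

Section row_of_cubes.
Variables (R : realType) (n : nat).
Local Notation Rn := 'rV[R]_n.+1.
Local Notation leb := (@lebesgue_rV R n.+1).

(** The corners of a row of cubes along the first axis: the factor j == ord0 keeps the
    other coordinates at 0. *)
Definition corner (L : R) (k : nat) (j : 'I_n.+1) : R := L *+ (k * (j == ord0)).

Definition cube (L : R) (k : nat) : set Rn :=
  [set x | forall j, `[corner L k j, corner L k j + L[%classic (x ord0 j)].

Lemma measurable_cube L k : measurable (cube L k).
Proof.
rewrite (_ : cube L k = \bigcap_(j in [set: 'I_n.+1])
    ((fun x : Rn => x ord0 j) @^-1` `[corner L k j, corner L k j + L[)).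
  apply: fin_bigcap_measurable => [|j _]; first exact: finite_finset.
  rewrite -[X in measurable X]setTI.
  by apply: (@measurable_coord R n.+1 j) => //; exact: measurable_itv.
by apply/seteqP; split => [x h j _|x h j]; exact: h.
Qed.

Lemma lebesgue_cube L k : 0 < L -> leb (cube L k) = (L ^+ n.+1)%:E.
Proof.
move=> L0; rewrite [LHS](lebesgue_rV_box (B := fun j => `[corner L k j, corner L k j + L[%classic))//.
rewrite (eq_bigr (fun=> L%:E)) ?prodEFin ?prodr_const ?card_ord// => j _.
by rewrite lebesgue_measure_itv/= lte_fin ltrDl L0 -EFinB addrAC subrr add0r.
Qed.

Lemma trivIset_cube L : 0 < L -> trivIset setT (cube L).
Proof.
move=> L0; apply/trivIsetP => i k _ _; apply: contraNeq => /set0P[x [xi xk]].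
wlog ik : i k xi xk / (i <= k)%N => [H|].
  by case/orP: (leq_total i k) => ik; [|rewrite eq_sym]; exact: H.
rewrite eqn_leq ik leqNgt/=; apply/negP => {}ik.
have := xi ord0; have := xk ord0; rewrite /= !in_itv/= /corner eqxx !muln1.
move=> /andP[xk1 _] /andP[_ xi2].
have : L *+ i.+1 <= L *+ k by rewrite ler_pMn2l.
by rewrite mulrSr leNgt (le_lt_trans xk1).
Qed.

Lemma cube_coord L k x j : 0 < L -> cube L k x -> `|x ord0 j| <= L * k.+1%:R.
Proof.
move=> L0 /(_ j); rewrite /= in_itv/= /corner => /andP[x1 x2].
have c0 : 0 <= L *+ (k * (j == ord0)) by rewrite mulrn_wge0// ltW.
rewrite ger0_norm ?(le_trans c0)// (le_trans (ltW x2))// mulr_natr mulrSr lerD2r.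
by rewrite ler_pMn2l//; case: eqP; rewrite ?muln1 ?muln0.
Qed.

Lemma enorm_cube_le L k x : 0 < L -> cube L k x -> enorm x <= n.+1%:R * L * k.+1%:R.
Proof.
move=> L0 xk; rewrite /enorm -mulrA.
have c0 : 0 <= L * k.+1%:R by rewrite mulr_ge0// ltW.
have r0 : 0 <= n.+1%:R * (L * k.+1%:R) by rewrite mulr_ge0.
rewrite -[leRHS](ger0_norm r0) -sqrtr_sqr ler_wsqrtr//.
apply: (@le_trans _ _ (n.+1%:R * (L * k.+1%:R) ^+ 2)).
  rewrite /dotr mulr_natl -[n.+1 in leRHS]card_ord -sumr_const; apply: ler_sum => j _.
  by rewrite -expr2 -real_normK ?num_real// lerXn2r ?nnegrE// cube_coord.
by rewrite [leRHS]exprMn ler_wpM2r ?sqr_ge0// expr2 ler_peMr// ler1n.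
Qed.

Lemma enorm_cube_ge L k x : 0 < L -> cube L k x -> L * k%:R <= enorm x.
Proof.
move=> L0 /(_ ord0); rewrite /= in_itv/= /corner eqxx muln1 => /andP[x1 _].
rewrite mulr_natr (le_trans x1)// (le_trans (ler_norm _))// -sqrtr_sqr.
by rewrite ler_wsqrtr// /dotr (bigD1 ord0)//= -expr2 lerDl sumr_ge0// => j _; rewrite -expr2 sqr_ge0.
Qed.

Lemma notin_cube_center L k y : 0 < L -> ~ cube L k y ->
  exists j, L / 2 <= `|y ord0 j - (corner L k j + L / 2)|.
Proof.
move=> L0 /existsNP[j]; rewrite /= in_itv/= => /negP h; exists j.
rewrite leNgt; apply: contra h; rewrite ltr_norml; lra.
Qed.

End row_of_cubes.

Lemma series_harmonic_shift_dvg (R : realType) (c : R) (k0 : nat) (u : nat -> R) : 0 < c ->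
  (forall i, c / (k0 + i).+1%:R <= u i) -> series u @ \oo --> +oo.
Proof.
move=> c0 cu; apply/cvgryPge => A.
have hdv : series (@harmonic R) @ \oo --> +oo.
  apply: nondecreasing_dvgn_lt; last exact: dvg_harmonic.
  by apply: nondecreasing_series => i _ _; exact: harmonic_ge0.
have /cvgryPge /(_ (A / c + series (@harmonic R) k0)) := hdv.
move=> [m _ hm]; exists m => // i /= mi.
have := hm (k0 + i)%N; rewrite /= => /(_ (leq_trans mi (leq_addl _ _))).
rewrite -lerBrDr ler_pdivrMr// => /le_trans; apply.
rewrite -[X in X * c](_ : \sum_(0 <= j < i) harmonic (k0 + j)%N = _).
  rewrite mulr_suml; apply: ler_sum => j _; apply: le_trans (cu j).
  by rewrite /harmonic mulrC.
rewrite /series/= [X in _ = X - _](@big_cat_nat _ _ _ k0)//= ?leq_addr// addrAC subrr add0r.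
by rewrite -[X in _ = \sum_(X <= _ < _) _]add0n big_addn addKn; apply: eq_bigr => j _; rewrite addnC.
Qed.

Section poisson_holes.
Context d (Omega : measurableType d) (R : realType) (P : probability Omega R).
Variables (n : nat) (lambda : 'rV[R]_n.+1 -> R) (X : Omega -> set 'rV[R]_n.+1).
Hypothesis lambda_measurable : measurable_fun setT lambda.
Hypothesis lambda_ge0 : forall x, 0 <= lambda x.
Hypothesis lambda_littleo : (lambda : 'rV[R]_n.+1 -> R^o)
  =o_rV_infty (fun x => 1 + logp (enorm x) : R^o).
Hypothesis X_poisson : poisson_process P lambda X.
Local Notation leb := (@lebesgue_rV R n.+1).

Let lambda_le (e : R) : 0 < e -> exists M : R, forall x, M < enorm x ->
  lambda x <= e * (1 + logp (enorm x)).
Proof.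
move=> e0; have := lambda_littleo; rewrite eqoP => /(_ _ e0) [M _ hM].
exists M => x /hM /=; rewrite ger0_norm// ger0_norm//.
by rewrite addr_ge0// /logp le_max lexx orbT.
Qed.

Let logp_le (s t : R) : s <= t -> logp s <= logp t.
Proof.
move=> st; rewrite /logp ge_max le_max le_max lexx !orbT andbT.
have [s0|s0] := ltP 0 s; first by rewrite ler_ln// ?posrE ?(lt_le_trans s0)// st.
by rewrite ln0// lexx orbT.
Qed.

(** exp (- log^+ t) = 1 / max (1, t) *)
Let expR_logp (t : R) : 0 <= t -> (1 + t)^-1 <= expR (- logp t).
Proof.
move=> t0; rewrite expRN lef_pV2 ?posrE ?expR_gt0 ?ltr_wpDr//.
rewrite /logp maxEle; case: ifP => _; first by rewrite expR0 lerDl.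
have [->|tn0] := eqVneq t 0; first by rewrite ln0// expR0 addr0.
by rewrite lnK ?posrE ?lt0r ?tn0// lerDr.
Qed.

(** The cubes have side S = 2 L, so that missing one of them leaves a distance L to
    its center in some coordinate.  The little-o hypothesis is used with the inverse
    e of the volume of the cubes: then the volume disappears from the bound r on the
    integrals of the intensity, and exp (- r) decays no faster than the harmonic
    sequence. *)
Lemma ae_holes (L : R) : 0 < L ->
  {ae P, forall w, exists c : 'rV[R]_n.+1, forall y, X w y ->
     exists j, L <= `|y ord0 j - c ord0 j|}.
Proof.
move=> L0; pose S := 2 * L; have S0 : 0 < S by rewrite mulr_gt0.
pose e : R := (S ^+ n.+1)^-1.
have e0 : 0 < e by rewrite invr_gt0 exprn_gt0.
have [M hM] := lambda_le e0.
pose C := n.+1%:R * S.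
have C0 : 0 < C by rewrite mulr_gt0.
(* From the k0-th cube on, the norm exceeds M. *)
have [k0 hk0] : exists k0 : nat, M < S * k0%:R.
  exists (Num.bound `|M / S|); rewrite mulrC -ltr_pdivrMr//.
  by rewrite (le_lt_trans (ler_norm _))// archi_boundP.
pose r i := 1 + logp (C * (k0 + i).+1%:R).
have intQ i : (\int[leb]_(x in cube S (k0 + i)) (lambda x)%:E <= (r i)%:E)%E.
  apply: (@le_trans _ _ (\int[leb]_(x in cube S (k0 + i)) (e * r i)%:E)%E).
    apply: ge0_le_integral => //=.
    - exact: measurable_cube.
    - by move=> x _; rewrite lee_fin.
    - by apply: measurable_funTS; exact/measurable_EFinP.
    - move=> x xQ; rewrite lee_fin (le_trans (hM _ _))//.
        rewrite (lt_le_trans hk0)// (le_trans _ (enorm_cube_ge S0 xQ))//.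
        by rewrite ler_pM2l// ler_nat leq_addr.
      rewrite ler_pM2l// lerD2l logp_le//; exact: enorm_cube_le.
  rewrite integral_cst; last exact: measurable_cube.
  rewrite [X in (_ * X <= _)%E](lebesgue_cube n (k0 + i) S0).
  by rewrite -EFinM lee_fin mulrAC /e mulVf ?mul1r// gt_eqF// exprn_gt0.
have dvg : series (fun i => expR (- r i)) @ \oo --> +oo.
  apply: (@series_harmonic_shift_dvg _ (expR (-1) / (1 + C)) k0).
    by rewrite divr_gt0// ?expR_gt0// addr_gt0.
  move=> i; rewrite /r opprD expRD -mulrA ler_pM2l ?expR_gt0//.
  apply: le_trans (expR_logp _); last by rewrite mulr_ge0// ltW.
  rewrite -invfM lef_pV2 ?posrE ?mulr_gt0 ?addr_gt0// ?mulr_gt0//.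
  by rewrite mulrDl mul1r lerD2r ler1n.
have tQ : trivIset setT (fun i => cube (n := n) S (k0 + i)).
  apply/trivIsetP => i j _ _ ij.
  move/trivIsetP: (@trivIset_cube R n S S0); apply => //.
  by rewrite eqn_add2l.
have := ae_void lambda_ge0 X_poisson (fun i => @measurable_cube R n S (k0 + i)) tQ intQ dvg.
apply: filterS => w [i Xi].
exists (\row_j (corner S (k0 + i) j + S / 2)) => y Xy.
have [|j hj] := @notin_cube_center R n S (k0 + i) y S0.
  by move=> yQ; have : (X w `&` cube S (k0 + i)) y by []; rewrite Xi.
have S2 : S / 2 = L by rewrite /S mulrC mulKf.
by exists j; rewrite mxE -{1}S2.
Qed.

End poisson_holes.

Theorem proposition2p3 (R : realType) (d : nat) (d_ge1 : (1 <= d)%N)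
    (disp : measure_display) (Omega : measurableType disp)
    (P : probability Omega R)
    (lambda : 'rV[R]_d -> R)
    (lambda_measurable : measurable_fun setT lambda)
    (lambda_ge0 : forall x, 0 <= lambda x)
    (lambda_littleo : (lambda : 'rV[R]_d -> R^o)
       =o_rV_infty (fun x => 1 + logp (enorm x) : R^o))
    (X : Omega -> set 'rV[R]_d)
    (X_poisson : poisson_process P lambda X) :
  {ae P, forall w, forall Y : set 'rV[R]_d, Y `<=` X w ->
     ~ sampling_inequality Y}.
Proof.
case: d d_ge1 lambda lambda_measurable lambda_ge0 lambda_littleo X X_poisson
  => // n _ lambda ml l0 lo X XP.
(* Countably many sizes suffice and keep the exceptional set negligible. *)
have : {ae P, forall w (k : nat), exists c : 'rV[R]_n.+1, forall y, X w y ->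
    exists j, k.+1%:R <= `|y ord0 j - c ord0 j|}.
  by apply: ae_foralln => k; exact: (ae_holes ml l0 lo XP).
apply: filterS => w holes Y YX; apply: holes_sampling_fails => K K0.
have [c hc] := holes (Num.bound K); exists c => y /YX /hc [j hj]; exists j.
apply: le_trans hj; rewrite ltW// (lt_trans (archi_boundP (ltW K0)))//.
by rewrite ltr_nat.
Qed.
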